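(* Assume that there exist a null sequence $\{h_\ell\}_{\ell\in\mathbb N}$ of positive numbers, an exponent $\beta>0$ independent of $u$, and constants $C_y>0$, $C_q>0$ such that for every $u\in U_{\mathrm{ad}}$ and every $\ell\in\mathbb N$ $$\|y_\ell-y_{\ell-1}\|^2_{L^2(\Box^{\mathbb N};H)}\le C_y h_\ell^\beta,\qquad \|B^\ast q_\ell-B^\ast q_{\ell-1}\|^2_{L^2(\Box^{\mathbb N};U)}\le C_q h_\ell^\beta .$$ Assume in addition that there exist an exponent $\alpha>0$ and constants $\widetilde C_Y(\theta)>0$, $\widetilde C_X(\theta)>0$ such that for every $\theta\in(0,\infty)$ $$|\mathbb E[Y-Y_\ell]|\le\widetilde C_Y(\theta)h_\ell^\alpha,\qquad \|\mathbb E[X-X_\ell]\|_U\le\widetilde C_X(\theta)h_\ell^\alpha$$ for every $u\in U_{\mathrm{ad}}$ and $\ell\in\mathbb N$. Furthermore, suppose that the cost $\mathcal C_\ell$ to evaluate the solution operator $S_\ell$ and its adjoint on a level $\ell$ satisfies $\mathcal C_\ell\le C_\gamma h_\ell^{-\gamma}$ for some constant $C_\gamma>0$ and exponent $\gamma>0$. Then, for every $u\in U_{\mathrm{ad}}$ and for any sufficiently small $\varepsilon>0$, there exist an integer $L$ and a multilevel Monte Carlo hierarchy $\{M_\ell\}_{\ell=1}^L$ such that the $\varepsilon^2$-accuracy of the multilevel gradient estimator, $$\mathbb E_k\bigl[\|\nabla\mathcal J(u)-\nabla\mathcal J^{\mathrm{ML}}(u)\|_U^2\bigr]\le\varepsilon^2,$$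 can be achieved at an asymptotic computational cost of order $$\mathcal C(\varepsilon)\lesssim_\theta\begin{cases}\varepsilon^{-2},&\beta>\gamma,\\ \varepsilon^{-2}|\log(\varepsilon)|^2,&\beta=\gamma,\\ \varepsilon^{-2-\frac{\gamma-\beta}{\alpha}},&\beta<\gamma.\end{cases}$$
   Context: **Problem.** $V\hookrightarrow H=H'\hookrightarrow V'$ is a Gelfand triplet of separable Hilbert spaces ($V$ continuously and densely embedded in $H$), $U=U'$ is a separable Hilbert space, and $U_{\mathrm{ad}}\subset U$ is nonempty, closed, convex and bounded. The uncertainty is $\boldsymbol\xi=(\xi_j)_{j\in\mathbb N}$, i.i.d. with $\xi_j\sim\mathcal U([-1,1])$, so $\boldsymbol\xi\in\Box^{\mathbb N}:=[-1,1]^{\mathbb N}$, on a complete probability space $(\Omega,\mathcal F,\mathbb P)$; for $Z=Z(\boldsymbol\xi)$, $\mathbb E[Z]$ is the integral over $\Box^{\mathbb N}$ with respect to $\bigotimes_j \mathrm d\xi_j/2$, and $L^2(\Box^{\mathbb N};\cdot)$ refers to this measure. For each $\boldsymbol\xi\in\Box^{\mathbb N}$, $a(\boldsymbol\xi;\cdot,\cdot)$ is a continuous bilinear form on $V$, uniformly coercive: $a(\boldsymbol\xi;v,v)\ge a_{\min}\|v\|_V^2$ with $a_{\min}>0$ independent of $\boldsymbol\xi$; the associated operators $A(\boldsymbol\xi)\in\mathcal L(V,V')$ depend continuously on $\boldsymbol\xi$. Let $B\in\mathcal L(U,V')$ with adjoint $B^\ast$, $g\in H$, $\lambda>0$, and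 let $\theta>0$ be the risk-aversion parameter. For $u\in U$, the state is $y=y(\boldsymbol\xi)=S[\boldsymbol\xi](u):=A(\boldsymbol\xi)^{-1}Bu\in V$ and the adjoint state $q=q(\boldsymbol\xi)\in V$ solves $\langle A^\ast(\boldsymbol\xi)q,v\rangle_{V',V}=\langle y-g,v\rangle_H$ for all $v\in V$. Put $\Phi(y):=\tfrac12\|y-g\|_H^2$, $X:=\exp(\theta\Phi(y))B^\ast q$ ($U$-valued), $Y:=\exp(\theta\Phi(y))$ (real-valued). The reduced objective, using the entropic risk measure, is $$\mathcal J(u)=\tfrac1\theta\log\bigl(\mathbb E[\exp(\theta\Phi(S[\cdot](u)))]\bigr)+\tfrac\lambda2\|u\|_U^2,\qquad \nabla\mathcal J(u)=\frac{\mathbb E[X]}{\mathbb E[Y]}+\lambda u .$$ **Discretization and multilevel gradient estimator.** $\{V_\ell\}_{\ell\ge1}\subset V$ are finite element subspaces of increasing dimension; $y_\ell=S_\ell[\boldsymbol\xi](u)\in V_\ell$ solves $a(\boldsymbol\xi;y_\ell,v_\ell)=\langle Bu,v_\ell\rangle_{V',V}$ and $q_\ell\in V_\ell$ solves $a(\boldsymbol\xi;v_\ell,q_\ell)=\langle y_\ell-g,v_\ell\rangle_H$, for all $v_\ell\in V_\ell$. Set $X_\ell:=\exp(\theta\Phi(y_\ell))B^\ast q_\ell$, $Y_\ell:=\exp(\theta\Phi(y_\ell))$ for $\ell\ge1$ (dependence of all these on $u$ is suppressed), with conventions $X_0:=0$, $Y_0:=0$ and $y_0:=0$, $q_0:=0$.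 For a finest level $L$ and sample sizes $\{M_\ell\}_{\ell=1}^L$ (positive integers, the ''hierarchy''), $$\mathbb E^{\mathrm{ML}}[X_L]=\sum_{\ell=1}^L\frac1{M_\ell}\sum_{m=1}^{M_\ell}\bigl(X_\ell^{(m)}-X_{\ell-1}^{(m)}\bigr),\qquad \mathbb E^{\mathrm{ML}}[Y_L]=\sum_{\ell=1}^L\frac1{M_\ell}\sum_{m=1}^{M_\ell}\bigl(Y_\ell^{(m)}-Y_{\ell-1}^{(m)}\bigr),$$ where both terms in the $m$-th difference at level $\ell$ are evaluated at the same realization $\boldsymbol\xi^{(m,\ell)}$, and all $\boldsymbol\xi^{(m,\ell)}$ are i.i.d. copies of $\boldsymbol\xi$, independent across $m$ and $\ell$. Then $$\nabla\mathcal J^{\mathrm{ML}}(u):=\frac{\mathbb E^{\mathrm{ML}}[X_L]}{\max\{1,\mathbb E^{\mathrm{ML}}[Y_L]\}}+\lambda u .$$ **Conventions.** $\mathbb E_k$ is the conditional expectation given the sigma-algebra $\mathcal F_k$ generated by all random variables drawn before iteration $k$ of the optimization algorithm; the samples used in $\nabla\mathcal J^{\mathrm{ML}}(u)$ are drawn afresh, independently of $\mathcal F_k$, so for fixed $u$ it is the expectation over these samples. $\mathcal C_\ell$ is the number of floating point operations or the computing time. The computational cost $\mathcal C(\varepsilon)$ is the total cost of evaluating the estimator, $\sum_{\ell=1}^L M_\ell(\mathcal C_\ell+\mathcal C_{\ell-1})$ with $\mathcal C_0:=0$. The symbol $\lesssim_\theta$ means inequality up to a multiplicative constant that may depend on $\theta$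 and on the fixed problem data and constants in the assumptions, but not on $\varepsilon$ or $u$.
   Formalization: The null sequence h_l is additionally assumed geometrically refined: r h_l <= h_{l+1} and h_{l+k} <= K rho^k h_l with r > 0, 0 < rho < 1; for arbitrary null sequences (e.g. h_l ~ 1/log l) the cost bound is false. *)

(* Defs.v *)
From HB Require Import structures.
From mathcomp Require Import all_boot all_order all_algebra.
From mathcomp Require Import all_classical all_reals all_analysis.

Set Implicit Arguments.
Unset Strict Implicit.
Unset Printing Implicit Defensive.

Import Order.TTheory GRing.Theory Num.Theory.
Import numFieldNormedType.Exports.

Local Open Scope classical_set_scope.
Local Open Scope ring_scope.

Record hilbert (R : realType) := Hilbert {
  hilbert_car :> completeNormedModType R;
  hdot : {dot hilbert_car for idfun};
  hdot_norm : forall x : hilbert_car, hdot x x = `|x| ^+ 2;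
  hilbert_separable :
    exists D : set hilbert_car, countable D /\ dense D
}.

(* Real sequences with the product sigma-algebra.  A parameter is a point xi of
   [box]; outside [box] nothing is assumed about parameter-dependent data. *)
Definition coordinate_events (R : realType) : set (set (nat -> R)) :=
  [set C | exists (j : nat) (A : set (measurableTypeR R)),
     measurable A /\ C = [set x | A (x j)]].
Arguments coordinate_events : clear implicits.

Definition rseq (R : realType) := g_sigma_algebraType (coordinate_events R).

Definition box (R : realType) : set (rseq R) :=
  [set x | forall j, -1 <= x j <= 1].
Arguments box : clear implicits.

Lemma ltN11 (R : realType) : -1 < 1 :> R.
Proof. exact: lt_trans (ltrN10 R) ltr01. Qed.

(* mu is the product over j of the laws d xi_j / 2 on [-1, 1]; its values on
   cylinders determine it. *)
Definition product_uniform (R : realType) (mu : probability (rseq R) R) :=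
  forall (n : nat) (A : nat -> set (measurableTypeR R)),
    (forall j, measurable (A j)) ->
    fine (mu [set x | forall j, (j < n)%N -> A j (x j)]) =
    \prod_(j < n) fine (uniform_prob (ltN11 R) (A j)).

Section bochner.
Context (R : realType) (d : measure_display) (T : measurableType d)
  (U : completeNormedModType R) (mu : {measure set T -> \bar R}) (D : set T).

(* A U-valued simple function, coded by the pairs (A_i, c_i) in
   sum_i 1_{A_i} c_i. *)
Definition vsimple_fun (s : seq (set T * U)) (x : T) : U :=
  \sum_(p <- s) \1_(p.1) x *: p.2.

Definition vsimple_int (s : seq (set T * U)) : U :=
  \sum_(p <- s) fine (mu (D `&` p.1)) *: p.2.

Definition is_bochner (f : T -> U) (I : U) :=
  exists s : nat -> seq (set T * U),
    [/\ forall n p, p \in s n -> measurable p.1 /\ (mu (D `&` p.1) < +oo)%E,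
        forall n, measurable_fun D (fun x => `|f x - vsimple_fun (s n) x|),
        (\int[mu]_(x in D) `|f x - vsimple_fun (s n) x|%:E)%E
          @[n --> \oo] --> 0%E
      & vsimple_int (s n) @[n --> \oo] --> I].

Definition bochner (f : T -> U) : U := xget 0 [set I | is_bochner f I].

End bochner.

(* A(xi) in L(V, V') and B in L(U, V') are given by the bounded bilinear forms
   <A(xi) v, w> = a(xi; v, w) and <B u, v>; the H-pairing of elements of V goes
   through the embedding [emb]. *)
Record problem (R : realType) (V H U : hilbert R) := Problem {
  emb : {linear V -> H};
  emb_continuous : continuous emb;
  emb_injective : injective emb;
  emb_dense : dense (range emb);
  Uad : set U;
  Uad_nonempty : Uad !=set0;
  Uad_closed : closed Uad;
  Uad_convex : convex_set (Uad : set (convex_lmodType U));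
  Uad_bounded : bounded_set Uad;
  form : rseq R -> {biscalar V};
  form_bounded : forall xi, box R xi ->
    exists C : R, forall v w, `|form xi v w| <= C * `|v| * `|w|;
  amin : R;
  amin_gt0 : 0 < amin;
  form_coercive : forall xi, box R xi ->
    forall v, amin * `|v| ^+ 2 <= form xi v v;
  (* xi |-> A(xi) is continuous from box, with the product topology, to L(V, V')
     with the operator norm *)
  form_continuous : forall xi0, box R xi0 -> forall e : R, 0 < e ->
    \forall xi \near within (box R) (nbhs (xi0 : {ptws nat -> R})),
      forall v w, `|form xi v w - form xi0 v w| <= e * `|v| * `|w|;
  ctrl : {bilinear U -> V -> R | *%R & *%R};
  ctrl_bounded : exists C : R, forall u v, `|ctrl u v| <= C * `|u| * `|v|;
  ctrl_adj : V -> U;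
  ctrl_adjP : forall u v, hdot U (ctrl_adj v) u = ctrl u v;
  target : H;
  lambda : R;
  lambda_gt0 : 0 < lambda;
  state : rseq R -> U -> V;
  stateP : forall xi u, box R xi ->
    forall v, form xi (state xi u) v = ctrl u v;
  adjoint : rseq R -> U -> V;
  adjointP : forall xi u, box R xi ->
    forall v, form xi v (adjoint xi u) =
              hdot H (emb (state xi u) - target) (emb v)
}.

Definition subspace_of_dim (R : realType) (V : completeNormedModType R)
    (W : set V) (n : nat) :=
  exists e : 'I_n -> V,
    (forall c : 'I_n -> R, \sum_i c i *: e i = 0 -> forall i, c i = 0) /\
    W = [set v | exists c : 'I_n -> R, v = \sum_i c i *: e i].

(* Levels are numbered from 1; index 0 carries the convention
   y_0 = 0, q_0 = 0. *)
Record discretization (R : realType) (V H U : hilbert R)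
    (pb : problem V H U) := Discretization {
  fe_space : nat -> set V;
  fe_dim : nat -> nat;
  fe_spaceP : forall l, (1 <= l)%N -> subspace_of_dim (fe_space l) (fe_dim l);
  fe_dim_increasing : forall l, (1 <= l)%N -> (fe_dim l < fe_dim l.+1)%N;
  fe_state : nat -> rseq R -> U -> V;
  fe_state0 : forall xi u, fe_state 0 xi u = 0;
  fe_state_in : forall l xi u, (1 <= l)%N -> box R xi ->
    fe_space l (fe_state l xi u);
  fe_stateP : forall l xi u, (1 <= l)%N -> box R xi ->
    forall v, fe_space l v -> form pb xi (fe_state l xi u) v = ctrl pb u v;
  fe_adjoint : nat -> rseq R -> U -> V;
  fe_adjoint0 : forall xi u, fe_adjoint 0 xi u = 0;
  fe_adjoint_in : forall l xi u, (1 <= l)%N -> box R xi ->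
    fe_space l (fe_adjoint l xi u);
  fe_adjointP : forall l xi u, (1 <= l)%N -> box R xi ->
    forall v, fe_space l v ->
      form pb xi v (fe_adjoint l xi u) =
      hdot H (emb pb (fe_state l xi u) - target pb) (emb pb v)
}.

Section gradient.
Context (R : realType) (V H U : hilbert R) (pb : problem V H U)
  (dc : discretization pb) (mu : probability (rseq R) R) (theta : R).

Definition misfit (y : V) : R := 2^-1 * `|emb pb y - target pb| ^+ 2.

Definition Yexact (u : U) (xi : rseq R) : R :=
  expR (theta * misfit (state pb xi u)).

Definition Xexact (u : U) (xi : rseq R) : U :=
  expR (theta * misfit (state pb xi u)) *: ctrl_adj pb (adjoint pb xi u).

(* Y_0 = 0 and X_0 = 0 by convention. *)
Definition Ylevel (u : U) (l : nat) (xi : rseq R) : R :=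
  if l is 0 then 0 else expR (theta * misfit (fe_state dc l xi u)).

Definition Xlevel (u : U) (l : nat) (xi : rseq R) : U :=
  if l is 0 then 0 else
  expR (theta * misfit (fe_state dc l xi u)) *:
    ctrl_adj pb (fe_adjoint dc l xi u).

Definition mean (f : rseq R -> R) : R := (\int[mu]_(xi in box R) f xi)%R.

Definition vmean (f : rseq R -> U) : U := bochner mu (box R) f.

Definition gradJ (u : U) : U :=
  (mean (Yexact u))^-1 *: vmean (Xexact u) + lambda pb *: u.

End gradient.

Definition ml_sum (R : realType) (W : lmodType R) (Om : Type)
    (xi : nat -> nat -> Om -> rseq R) (L : nat) (M : nat -> nat)
    (Z : nat -> rseq R -> W) (om : Om) : W :=
  \sum_(1 <= l < L.+1)
    (M l)%:R^-1 *: \sum_(m < M l) (Z l (xi l m om) - Z l.-1 (xi l m om)).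

Definition gradJ_ML (R : realType) (V H U : hilbert R) (pb : problem V H U)
    (dc : discretization pb) (theta : R) (Om : Type)
    (xi : nat -> nat -> Om -> rseq R) (L : nat) (M : nat -> nat)
    (u : U) (om : Om) : U :=
  (Num.max 1 (ml_sum xi L M (fun l z => Ylevel dc theta u l z : R^o) om))^-1
    *: ml_sum xi L M (Xlevel dc theta u) om
  + lambda pb *: u.

Definition ml_cost (R : realType) (C : nat -> R) (L : nat) (M : nat -> nat) : R :=
  \sum_(1 <= l < L.+1) (M l)%:R * (C l + C l.-1).

Definition cost_rate (R : realType) (alpha beta gamma e : R) : R :=
  if gamma < beta then e `^ (-2)
  else if beta == gamma then e `^ (-2) * `|ln e| ^+ 2
  else e `^ (-2 - (gamma - beta) / alpha).

Section sampling.
Context (R : realType) (d : measure_display) (Om : measurableType d)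
  (P : probability Om R).

Definition sample_events (xi : nat -> nat -> Om -> rseq R) : set (set Om) :=
  [set A | exists (l m : nat) (C : set (rseq R)),
     measurable C /\ A = xi l m @^-1` C].

Definition iid_samples (mu : probability (rseq R) R)
    (xi : nat -> nat -> Om -> rseq R) :=
  [/\ forall l m om, box R (xi l m om),
      forall l m, measurable_fun setT (xi l m),
      forall l m (C : set (rseq R)), measurable C -> P (xi l m @^-1` C) = mu C
    & forall (s : seq (nat * nat)) (C : nat * nat -> set (rseq R)),
        uniq s -> (forall i, measurable (C i)) ->
        fine (P (\bigcap_(i in [set` s]) xi i.1 i.2 @^-1` C i)) =
        \prod_(i <- s) fine (P (xi i.1 i.2 @^-1` C i))].

Definition sub_sigma_algebra_of_events (F : set (set Om)) :=
  sigma_algebra setT F /\ F `<=` measurable.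

Definition independent_of_samples (F : set (set Om))
    (xi : nat -> nat -> Om -> rseq R) :=
  forall A C, F A -> <<s sample_events xi >> C -> (P (A `&` C) = P A * P C)%E.

(* Z is a version of the conditional expectation of W given F. *)
Definition is_condexp (F : set (set Om)) (W Z : Om -> R) :=
  [/\ P.-integrable setT (EFin \o W),
      P.-integrable setT (EFin \o Z),
      forall A : set (measurableTypeR R), measurable A -> F (Z @^-1` A)
    & forall A, F A ->
        (\int[P]_(om in A) (Z om)%:E = \int[P]_(om in A) (W om)%:E)%E].

End sampling.

(* Standing assumption of multilevel Monte Carlo on the mesh widths: they are
   comparable to a geometric sequence (for instance h_l ~ s^(-l) with s > 1, or
   r h_l <= h_(l+1) <= rho h_l with 0 < r, rho < 1).
   For arbitrary null sequences the complexity bound is false: take V = H = l^2,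
   a the inner product, V_l = span(e_1, .., e_l), U the reals, B u = u b, g = 0,
   Uad = [1, 2], C_l = 1; then the error of the estimator is at least
   h_L := sum_(j > L) b_j^2, and if h_L ~ 1 / log L, the cost is at least
   L >= exp(c / e). *)
Definition geometric_refinement (R : realType) (h : nat -> R) :=
  exists r rho K : R, [/\ 0 < r, 0 < rho < 1,
    forall l, (1 <= l)%N -> r * h l <= h l.+1
  & forall l k, (1 <= l)%N -> h (l + k)%N <= K * rho ^+ k * h l].

(* Main.v *)
Require Import Defs.
From HB Require Import structures.
From mathcomp Require Import all_boot all_order all_algebra.
From mathcomp Require Import all_classical all_reals all_analysis.
From mathcomp Require Import measurable_realfun ring lra zify.

Set Implicit Arguments.
Unset Strict Implicit.
Unset Printing Implicit Defensive.

Import Order.TTheory GRing.Theory Num.Theory.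
Import numFieldNormedType.Exports.

Local Open Scope classical_set_scope.
Local Open Scope ring_scope.

(** The error of the gradient estimator is the error of a quotient. Both
    denominators are at least 1 and [E[X]] is bounded, so it is at most the error
    of the numerator plus a multiple of the error of the denominator
    ([ratio_error]). Each of these is the error of a multilevel sum: its mean
    square is bounded by the squared bias on the finest level plus the second
    moments of the level increments divided by the numbers of samples, because
    the centered summands are independent and orthogonal in mean
    ([mean_square_sum_le], [multilevel_error]).

    The increments of [X] and [Y] inherit the rate [beta] of the states and the
    adjoints: coercivity bounds all Galerkin solutions uniformly over the bounded
    admissible set, and the exponential is Lipschitz on bounded sets
    ([galerkin_bounds], [increment_rates]).

    The usual complexity argument then takes the first level whose bias is below
    the tolerance and sample sizes proportional to [h l `^ ((beta + gamma) / 2)]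
    ([sample_sizes], [mlmc_complexity]). Rounding the sample sizes up costs one
    sample on every level, about [e `^ (- (gamma / alpha))], and this would exceed
    the claimed rates if [alpha] were less than half of both [beta] and [gamma].
    But the bias is a sum of increments of means beyond the level, which decay
    with exponent [beta / 2] on geometric meshes, so that [alpha] may be replaced
    by the maximum of [alpha] and [beta / 2] ([bias_rate]).

    Hilbert space valued expectations are handled by strong measurability.
    Galerkin solutions depend continuously on the parameter, and rounding
    finitely many coordinates of the parameter is a simple map that converges
    coordinatewise; hence all observables are bounded limits of simple maps
    ([galerkin_bsm]). For such maps the Bochner integral exists and is determined
    by testing against vectors ([bochner_weak_mean]), and statements about laws
    and independence of the samples reduce to finite sums ([bsm_transfer],
    [independent_expectation]). The squared error is such a map of the samples,
    which are independent of the past, so its conditional expectation is constant,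
    equal to its expectation ([condexp_samples]). *)

(** * Inner products *)

Lemma cvg_dist (R : realType) (V : normedModType R) (f : nat -> V) (l : V)
    (g : nat -> R) :
  (forall n, `|f n - l| <= g n) -> g n @[n --> \oo] --> 0 ->
  f n @[n --> \oo] --> l.
Proof.
move=> fg g0; apply/cvgrPdist_lt => e e0; near=> n.
rewrite distrC (le_lt_trans (fg n))//; near: n.
exact: (@cvgr_lt _ _ _ _ _ _ g0).
Unshelve. all: by end_near. Qed.

(** Covers the Hilbert spaces and also the real line with its product, so that
    the estimators of [E[X]] and [E[Y]] obey the same lemmas. *)
Definition inner_product (R : realType) (W : normedModType R)
    (dot : W -> W -> R) :=
  [/\ forall u v, dot u v = dot v u,
      forall a u v w, dot (a *: u + v) w = a * dot u w + dot v w
    & forall u, dot u u = `|u| ^+ 2].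

Section inner_product_theory.
Context (R : realType) (W : normedModType R) (dot : W -> W -> R).
Context (dotP : inner_product dot).

Lemma ip_sym u v : dot u v = dot v u.
Proof. by case: dotP. Qed.

Lemma ip_norm u : dot u u = `|u| ^+ 2.
Proof. by case: dotP. Qed.

Lemma ip_linl a u v w : dot (a *: u + v) w = a * dot u w + dot v w.
Proof. by case: dotP. Qed.

Lemma ip_Dl u v w : dot (u + v) w = dot u w + dot v w.
Proof. by rewrite -[u]scale1r ip_linl mul1r scale1r. Qed.

Lemma ip_0l w : dot 0 w = 0.
Proof. by apply: (addIr (dot 0 w)); rewrite -ip_Dl !add0r. Qed.

Lemma ip_Zl a u w : dot (a *: u) w = a * dot u w.
Proof. by rewrite -[a *: u]addr0 ip_linl ip_0l addr0. Qed.

Lemma ip_Nl u w : dot (- u) w = - dot u w.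
Proof. by rewrite -scaleN1r ip_Zl mulN1r. Qed.

Lemma ip_Bl u v w : dot (u - v) w = dot u w - dot v w.
Proof. by rewrite ip_Dl ip_Nl. Qed.

Lemma ip_Dr u v w : dot u (v + w) = dot u v + dot u w.
Proof. by rewrite ip_sym ip_Dl !(ip_sym u). Qed.

Lemma ip_Zr a u w : dot u (a *: w) = a * dot u w.
Proof. by rewrite ip_sym ip_Zl (ip_sym u). Qed.

Lemma ip_Nr u v : dot u (- v) = - dot u v.
Proof. by rewrite ip_sym ip_Nl (ip_sym u). Qed.

Lemma ip_Br u v w : dot u (v - w) = dot u v - dot u w.
Proof. by rewrite ip_sym ip_Bl !(ip_sym u). Qed.

Lemma ip_suml (I : Type) (s : seq I) (F : I -> W) w :
  dot (\sum_(i <- s) F i) w = \sum_(i <- s) dot (F i) w.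
Proof.
elim: s => [|i s IHs]; first by rewrite !big_nil ip_0l.
by rewrite !big_cons ip_Dl IHs.
Qed.

Lemma cauchy_schwarz u v : (`|dot u v| <= `|u| * `|v|)%R.
Proof.
have [->|v0] := eqVneq v 0; first by rewrite ip_sym ip_0l !normr0 mulr0.
have nv : (0 : R) < `|v| by rewrite normr_gt0.
have : 0 <= dot (`|v| ^+ 2 *: u - dot u v *: v) (`|v| ^+ 2 *: u - dot u v *: v).
  by rewrite ip_norm exprn_ge0.
rewrite ip_Bl !ip_Br !ip_Zl !ip_Zr !ip_norm (ip_sym v u) => h.
have : 0 <= `|v| ^+ 2 * (`|v| ^+ 2 * `|u| ^+ 2 - dot u v ^+ 2).
  by apply: le_trans h _; rewrite le_eqVlt; apply/orP; left; apply/eqP; ring.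
rewrite pmulr_rge0 ?exprn_gt0// subr_ge0 => {}h.
rewrite -(@ler_pXn2r _ 2)// ?nnegrE ?mulr_ge0//.
by rewrite exprMn real_normK ?num_real// mulrC.
Qed.

Lemma ip_nondeg u v : (forall w, dot u w = dot v w) -> u = v.
Proof.
move=> h; apply/eqP; rewrite -subr_eq0 -normr_eq0 -sqrf_eq0.
by rewrite -ip_norm ip_Bl h subrr.
Qed.

Lemma normB_sqr_le (u v : W) : `|u - v| ^+ 2 <= 2 * `|u| ^+ 2 + 2 * `|v| ^+ 2.
Proof.
have : 0 <= dot (u + v) (u + v) by rewrite ip_norm exprn_ge0.
rewrite -!ip_norm !(ip_Dl, ip_Dr, ip_Nl, ip_Nr) (ip_sym v u) => h; lra.
Qed.

Lemma cvg_ip (a b : nat -> W) (u v : W) :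
  a n @[n --> \oo] --> u -> b n @[n --> \oo] --> v ->
  dot (a n) (b n) @[n --> \oo] --> dot u v.
Proof.
move=> au bv.
apply: (@cvg_dist _ _ _ _ (fun n => `|a n - u| * `|b n| + `|u| * `|b n - v|)).
  move=> n; have -> : dot (a n) (b n) - dot u v =
      dot (a n - u) (b n) + dot u (b n - v).
    by rewrite ip_Bl ip_Br addrA subrK.
  by apply: le_trans (ler_normD _ _) _; rewrite lerD ?cauchy_schwarz.
have nn0 (x : nat -> W) l : x n @[n --> \oo] --> l ->
    `|x n - l| @[n --> \oo] --> (0 : R).
  move=> xl; rewrite -(@normr0 _ W) -(subrr l).
  by apply: cvg_norm; apply: cvgB => //; exact: cvg_cst.
rewrite -[0]addr0 -[X in X + _](mul0r `|v|) -[X in _ + X](mulr0 `|u|).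
apply: cvgD; apply: cvgM; [exact: nn0|exact: cvg_norm|exact: cvg_cst|exact: nn0].
Qed.

End inner_product_theory.

(** * Bounded strongly measurable maps *)

Section finite_valued.
Context d (T : measurableType d).

(** An index with measurable fibres, rather than measurability of [f], keeps
    the values in an arbitrary type: pairs and images of finite valued maps are
    again finite valued. *)
Definition finite_valued (X : Type) (f : T -> X) :=
  exists (I : finType) (i : T -> I) (c : I -> X),
    (forall k, measurable (i @^-1` [set k])) /\ f = c \o i.

Lemma finite_valued_comp (X Y : Type) (g : X -> Y) (f : T -> X) :
  finite_valued f -> finite_valued (g \o f).
Proof. by move=> [I [i [c [mi ->]]]]; exists I, i, (g \o c). Qed.

Lemma finite_valued_cst (X : Type) (x : X) : finite_valued (fun=> x).
Proof.
exists unit, (fun=> tt), (fun=> x); split=> // -[].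
by rewrite (_ : _ @^-1` _ = setT)//; apply/seteqP.
Qed.

Lemma finite_valued_pair (X Y : Type) (f : T -> X) (g : T -> Y) :
  finite_valued f -> finite_valued g -> finite_valued (fun x => (f x, g x)).
Proof.
move=> [I [i [c [mi ->]]]] [J [j [b [mj ->]]]].
exists (I * J)%type, (fun x => (i x, j x)), (fun k => (c k.1, b k.2)).
split=> // -[k1 k2].
rewrite (_ : _ @^-1` _ = i @^-1` [set k1] `&` j @^-1` [set k2]).
  exact: measurableI.
by apply/seteqP; split=> x /= [-> ->].
Qed.

Lemma finite_valued_preimage (X : Type) (f : T -> X) (A : set X) :
  finite_valued f -> measurable (f @^-1` A).
Proof.
move=> [I [i [c [mi ->]]]].
rewrite (_ : _ @^-1` _ = \bigcup_(k in c @^-1` A) i @^-1` [set k]).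
  by apply: fin_bigcup_measurable => //; exact: finite_finset.
apply/seteqP; split=> [x Ax|x [k Ak /= ->]//]; by exists (i x).
Qed.

Lemma finite_valued_measurable (R : realType) (f : T -> R) :
  finite_valued f -> measurable_fun setT f.
Proof. by move=> ff _ A mA; rewrite setTI; exact: finite_valued_preimage. Qed.

End finite_valued.

Lemma finite_valued_precomp d d' (T : measurableType d) (T' : measurableType d')
    (X : Type) (f : T -> X) (phi : T' -> T) :
  measurable_fun setT phi -> finite_valued f -> finite_valued (f \o phi).
Proof.
move=> mphi [I [i [c [mi ->]]]]; exists I, (i \o phi), c; split=> // k.
by rewrite comp_preimage -[X in measurable X]setTI; exact: mphi.
Qed.

Section strongly_measurable.
Context (R : realType) d (T : measurableType d).

(** Uniformly bounded pointwise limits of simple maps. The bound puts dominated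
    convergence at disposal everywhere, and an identity between means has to be
    checked on finite sums only. *)
Definition bsm (W : normedModType R) (f : T -> W) :=
  exists (B : R) (g : nat -> T -> W),
    [/\ forall n, finite_valued (g n), forall n x, `|g n x| <= B
      & forall x, g n x @[n --> \oo] --> f x].

Lemma bsm_bounded (W : normedModType R) (f : T -> W) :
  bsm f -> exists B : R, forall x, `|f x| <= B.
Proof.
move=> [B [g [_ gB gf]]]; exists B => x.
have gc : `|g n x| @[n --> \oo] --> `|f x| by exact: cvg_norm.
rewrite -(cvg_lim _ gc)//; apply: limr_le; first exact: cvgP gc.
by apply: nearW => n; exact: gB.
Qed.

Lemma bsm_cst (W : normedModType R) (w : W) : bsm (fun=> w).
Proof.
exists `|w|, (fun _ _ => w); split=> // [_|x]; first exact: finite_valued_cst.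
exact: cvg_cst.
Qed.

(** Only the approximating sequences are transported, so [phi] has to be
    sequentially continuous and bounded on bounded sets; the closure properties
    below are instances. *)
Lemma bsm_map2 (W1 W2 W : normedModType R) (phi : W1 -> W2 -> W)
    (f1 : T -> W1) (f2 : T -> W2) :
  (forall B : R, exists B' : R,
     forall x y, `|x| <= B -> `|y| <= B -> `|phi x y| <= B') ->
  (forall (a : nat -> W1) (b : nat -> W2) x y,
     a n @[n --> \oo] --> x -> b n @[n --> \oo] --> y ->
     phi (a n) (b n) @[n --> \oo] --> phi x y) ->
  bsm f1 -> bsm f2 -> bsm (fun x => phi (f1 x) (f2 x)).
Proof.
move=> phiB phic [B1 [g1 [g1f g1B g1c]]] [B2 [g2 [g2f g2B g2c]]].
have [B' B'P] := phiB (Num.max B1 B2).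
exists B', (fun n x => phi (g1 n x) (g2 n x)); split=> [n|n x|x].
- pose h (p : W1 * W2) := phi p.1 p.2.
  exact: (@finite_valued_comp _ _ _ _ h _ (finite_valued_pair (g1f n) (g2f n))).
- by apply: B'P; rewrite le_max ?g1B ?g2B ?orbT.
- exact: phic.
Qed.

Lemma bsm_map (W1 W : normedModType R) (phi : W1 -> W) (f : T -> W1) :
  (forall B : R, exists B' : R, forall x, `|x| <= B -> `|phi x| <= B') ->
  continuous phi -> bsm f -> bsm (fun x => phi (f x)).
Proof.
move=> phiB phic bf.
apply: (@bsm_map2 _ _ _ (fun x _ => phi x) f f) => // [B|a b x y ax _].
  by have [B' h] := phiB B; exists B' => x _ xB _; exact: h.
exact: (cvg_comp _ _ ax (phic x)).
Qed.

Lemma bsmD (W : normedModType R) (f g : T -> W) :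
  bsm f -> bsm g -> bsm (fun x => f x + g x).
Proof.
apply: (@bsm_map2 W W W (fun a b => a + b)) => [B|*]; last exact: cvgD.
by exists (B + B) => x y xB yB; apply: le_trans (ler_normD _ _) (lerD _ _).
Qed.

Lemma bsmZ (W : normedModType R) (f : T -> R) (g : T -> W) :
  bsm (f : T -> R^o) -> bsm g -> bsm (fun x => f x *: g x).
Proof.
apply: (@bsm_map2 R^o W W (fun a w => a *: w)) => [B|*]; last exact: cvgZ.
by exists (B * B) => x y xB yB; rewrite normrZ ler_pM.
Qed.

Lemma bsmB (W : normedModType R) (f g : T -> W) :
  bsm f -> bsm g -> bsm (fun x => f x - g x).
Proof.
apply: (@bsm_map2 W W W (fun a b => a - b)) => [B|*]; last exact: cvgB.
by exists (B + B) => x y xB yB; apply: le_trans (ler_normB _ _) (lerD _ _).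
Qed.

Lemma bsm_sum (W : normedModType R) (I : Type) (s : seq I) (F : I -> T -> W) :
  (forall i, bsm (F i)) -> bsm (fun x => \sum_(i <- s) F i x).
Proof.
move=> bF; elim: s => [|i s IHs].
  by under eq_fun do rewrite big_nil; exact: bsm_cst.
by under eq_fun do rewrite big_cons; exact: bsmD.
Qed.

Lemma bsm_norm (W : normedModType R) (f : T -> W) :
  bsm f -> bsm (fun x => `|f x| : R^o).
Proof.
apply: (@bsm_map W R^o (fun w => `|w|)) => [B|]; last exact: norm_continuous.
by exists B => x; rewrite normr_id.
Qed.

Lemma bsm_ip (W : normedModType R) (dot : W -> W -> R) (f g : T -> W) :
  inner_product dot -> bsm f -> bsm g -> bsm (fun x => dot (f x) (g x) : R^o).
Proof.
move=> dotP; apply: (@bsm_map2 W W R^o dot) => [B|*]; last exact: cvg_ip.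
exists (B * B) => x y xB yB.
by rewrite (le_trans (cauchy_schwarz dotP _ _))// ler_pM.
Qed.

Lemma bsm_measurable (f : T -> R) : bsm (f : T -> R^o) -> measurable_fun setT f.
Proof.
move=> [B [g [gf _ gc]]].
apply: (@measurable_fun_cvg _ _ _ _ g) => // m.
exact: finite_valued_measurable.
Qed.

End strongly_measurable.

Lemma bsm_precomp (R : realType) d d' (T : measurableType d)
    (T' : measurableType d') (W : normedModType R) (f : T -> W) (phi : T' -> T) :
  measurable_fun setT phi -> bsm f -> bsm (f \o phi).
Proof.
move=> mphi [B [g [gf gB gc]]]; exists B, (fun n => g n \o phi).
split=> [n|n x|x]; [exact: finite_valued_precomp|exact: gB|exact: gc].
Qed.

(** * Integrals and weak means *)

Section bounded_integrals.
Context (R : realType) d (T : measurableType d) (P : probability T R).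
Context (D : set T) (mD : measurable D).

Lemma bsm_integrable (f : T -> R) :
  bsm (f : T -> R^o) -> P.-integrable D (EFin \o f).
Proof.
move=> bf; apply: measurable_bounded_integrable => //.
- by rewrite (le_lt_trans (probability_le1 P mD))// ltry.
- exact: measurable_funTS (bsm_measurable bf).
- have [B fB] := bsm_bounded bf.
  exists B; split; first exact: num_real.
  by move=> x Bx y _; exact: le_trans (fB y) (ltW Bx).
Qed.

Lemma bsm_integralE (f : T -> R) : bsm (f : T -> R^o) ->
  (\int[P]_(x in D) (f x)%:E = (\int[P]_(x in D) f x)%:E)%E.
Proof.
by move=> bf; rewrite /Rintegral fineK//; exact/integrable_fin_num/bsm_integrable.
Qed.

Lemma bsm_integral_cvg (B : R) (g : nat -> T -> R) (f : T -> R) :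
  (forall n, bsm (g n : T -> R^o)) -> (forall n x, `|g n x| <= B) ->
  (forall x, g n x @[n --> \oo] --> f x) ->
  (\int[P]_(x in D) g n x) @[n --> \oo] --> \int[P]_(x in D) f x.
Proof.
move=> bg gB gf.
have mf : measurable_fun D f.
  apply: (@measurable_fun_cvg _ _ _ _ g) => // m.
  exact: measurable_funTS (bsm_measurable (bg m)).
have iB : P.-integrable D (EFin \o cst B) by exact: finite_measure_integrable_cst.
have [] := @dominated_convergence _ _ _ P D mD (fun n => EFin \o g n) (EFin \o f)
  (EFin \o cst B).
- move=> n; apply/measurable_EFinP.
  exact: measurable_funTS (bsm_measurable (bg n)).
- exact/measurable_EFinP.
- by apply: aeW => x _; apply: cvg_EFin (gf x); exact: nearW.
- exact: iB.
- by apply: aeW => x n _; rewrite lee_fin.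
move=> intf _ cvgf; apply: fine_cvg.
by rewrite fineK; [exact: cvgf|exact: integrable_fin_num].
Qed.

End bounded_integrals.

Section weak_mean.
Context (R : realType) d (T : measurableType d) (P : probability T R).
Context (D : set T) (mD : measurable D).
Context (W : normedModType R) (dot : W -> W -> R) (dotP : inner_product dot).

(** Testing against all vectors reduces the vector integral to real ones. *)
Definition weak_mean (f : T -> W) (m : W) :=
  forall v, dot m v = \int[P]_(x in D) dot (f x) v.

Let bdot (f : T -> W) v : bsm f -> bsm (fun x => dot (f x) v : R^o).
Proof. by move=> bf; apply: bsm_ip => //; exact: bsm_cst. Qed.

Lemma weak_mean_uniq f m m' : weak_mean f m -> weak_mean f m' -> m = m'.
Proof. by move=> h h'; apply: (ip_nondeg dotP) => v; rewrite h h'. Qed.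

Lemma weak_meanD f g m p : bsm f -> bsm g ->
  weak_mean f m -> weak_mean g p -> weak_mean (fun x => f x + g x) (m + p).
Proof.
move=> bf bg fm gp v; rewrite ip_Dl// fm gp -RintegralD//; last 2 first.
  exact/bsm_integrable/bdot.
  exact/bsm_integrable/bdot.
by apply: eq_Rintegral => x _; rewrite (ip_Dl dotP).
Qed.

Lemma weak_meanB f g m p : bsm f -> bsm g ->
  weak_mean f m -> weak_mean g p -> weak_mean (fun x => f x - g x) (m - p).
Proof.
move=> bf bg fm gp v; rewrite ip_Bl// fm gp -RintegralB//; last 2 first.
  exact/bsm_integrable/bdot.
  exact/bsm_integrable/bdot.
by apply: eq_Rintegral => x _; rewrite (ip_Bl dotP).
Qed.

(** Test [m] against itself and use the Cauchy-Schwarz inequality under the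
    integral. *)
Lemma weak_mean_norm_le f m : bsm f -> weak_mean f m ->
  `|m| <= \int[P]_(x in D) `|f x|.
Proof.
move=> bf fm; have [->|m0] := eqVneq m 0.
  by rewrite normr0; apply: Rintegral_ge0.
rewrite -(@ler_pM2r _ `|m|) ?normr_gt0//.
rewrite -expr2 -(ip_norm dotP) fm -RintegralZr//; last first.
  exact/bsm_integrable/bsm_norm.
apply: le_Rintegral => //; [exact/bsm_integrable/bdot| |].
  apply/bsm_integrable/(@bsmZ _ _ _ R^o (fun x => `|f x|)) => //.
    exact: bsm_norm.
  exact: bsm_cst.
by move=> x _; rewrite (le_trans (ler_norm _))//; exact: cauchy_schwarz.
Qed.

End weak_mean.

Section simple_functions.
Context (R : realType) d (T : measurableType d).

Definition measurable_pieces (W : choiceType) (s : seq (set T * W)) :=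
  forall p, p \in s -> measurable p.1.

Lemma measurable_pieces_cons (W : choiceType) (p : set T * W) s :
  measurable_pieces (p :: s) <-> measurable p.1 /\ measurable_pieces s.
Proof.
split=> [h|[p1 h] q]; last by rewrite inE => /predU1P[->//|]; exact: h.
by split=> [|q qs]; apply: h; rewrite inE ?eqxx// qs orbT.
Qed.

Lemma finite_valued_indic (A : set T) :
  measurable A -> finite_valued (\1_A : T -> R).
Proof.
move=> mA; exists bool, (fun x => x \in A), (fun b : bool => b%:R).
split=> [[]|]; last by [].
- rewrite (_ : _ @^-1` _ = A)//.
  by apply/seteqP; split=> x /=; [move/set_mem|move/mem_set].
- rewrite (_ : _ @^-1` _ = ~` A); first exact: measurableC.
  apply/seteqP; split=> x /=; first by move/negbT; rewrite notin_setE.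
  by move=> nA; apply/negbTE; rewrite notin_setE.
Qed.

Lemma bsm_indic (A : set T) : measurable A -> bsm (\1_A : T -> R^o).
Proof.
move=> mA; exists 1, (fun=> \1_A); split=> [_|_ x|x].
- exact: finite_valued_indic.
- by rewrite indicE normr_nat lern1 leq_b1.
- exact: cvg_cst.
Qed.

Context (W : completeNormedModType R).

Lemma bsm_vsimple (s : seq (set T * W)) : measurable_pieces s -> bsm (vsimple_fun s).
Proof.
elim: s => [_|p s IHs /measurable_pieces_cons[mp ms]].
  rewrite (_ : vsimple_fun [::] = fun=> 0); first exact: bsm_cst.
  by apply/funext => x; rewrite /vsimple_fun big_nil.
rewrite (_ : vsimple_fun _ = fun x => \1_(p.1) x *: p.2 + vsimple_fun s x).
  by apply: bsmD; [apply: bsmZ; [exact: bsm_indic|exact: bsm_cst]|exact: IHs].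
by apply/funext => x; rewrite /vsimple_fun big_cons.
Qed.

Lemma finite_valued_vsimple (g : T -> W) : finite_valued g ->
  exists s : seq (set T * W), measurable_pieces s /\ vsimple_fun s = g.
Proof.
move=> [I [i [c [mi ->]]]].
exists [seq (i @^-1` [set k], c k) | k <- enum I]; split.
  by move=> p /mapP[k _ ->]; exact: mi.
apply/funext => x; rewrite /vsimple_fun big_map big_enum /=.
rewrite (bigD1 (i x))//= big1 => [|k kx].
  by rewrite addr0 indicE mem_set// scale1r.
rewrite indicE memNset ?scale0r// => /= e.
by rewrite e eqxx in kx.
Qed.

Context (P : probability T R) (D : set T) (mD : measurable D).
Context (dot : W -> W -> R) (dotP : inner_product dot).

Lemma weak_mean_vsimple (s : seq (set T * W)) : measurable_pieces s ->
  weak_mean P D dot (vsimple_fun s) (vsimple_int P D s).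
Proof.
elim: s => [_|p s IHs /measurable_pieces_cons[mp ms]].
  rewrite (_ : vsimple_fun [::] = fun=> 0).
    rewrite /vsimple_int big_nil => v; rewrite (ip_0l dotP).
    by rewrite Rintegral_cst// mul0r.
  by apply/funext => x; rewrite /vsimple_fun big_nil.
rewrite (_ : vsimple_fun _ = fun x => \1_(p.1) x *: p.2 + vsimple_fun s x); last first.
  by apply/funext => x; rewrite /vsimple_fun big_cons.
rewrite /vsimple_int big_cons; apply: weak_meanD => //.
- by apply: bsmZ; [exact: bsm_indic|exact: bsm_cst].
- exact: bsm_vsimple.
- move=> v; rewrite (ip_Zl dotP).
  rewrite (@eq_Rintegral _ _ _ P D (fun x => \1_(p.1) x * dot p.2 v)); last first.
    by move=> x _; rewrite (ip_Zl dotP).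
  rewrite RintegralZr//; last exact/bsm_integrable/bsm_indic.
  by rewrite /Rintegral integral_indic// setIC.
- exact: IHs.
Qed.

Lemma weak_mean_dist f g m v : bsm f -> bsm g -> weak_mean P D dot g m ->
  `|dot m v - \int[P]_(x in D) dot (f x) v|
    <= `|v| * \int[P]_(x in D) `|f x - g x|.
Proof.
move=> bf bg gm; rewrite gm -RintegralB//; last 2 first.
- by apply/bsm_integrable/bsm_ip => //; exact: bsm_cst.
- by apply/bsm_integrable/bsm_ip => //; exact: bsm_cst.
have bd : bsm (fun x => dot (g x) v - dot (f x) v : R^o).
  by apply: (@bsmB _ _ _ R^o); apply: bsm_ip => //; exact: bsm_cst.
have bn : bsm (fun x => `|f x - g x| : R^o) by exact/bsm_norm/bsmB.
apply: le_trans (le_normr_Rintegral _ _) _ => //; first exact: bsm_integrable.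
rewrite -RintegralZl//; last exact: bsm_integrable.
apply: le_Rintegral => //.
- exact/bsm_integrable/(@bsm_norm _ _ _ R^o).
- apply/bsm_integrable/(@bsmZ _ _ _ R^o (fun=> `|v|)) => //; exact: bsm_cst.
move=> x _; rewrite -(ip_Bl dotP) distrC mulrC.
by rewrite (le_trans (cauchy_schwarz dotP _ _))// mulrC distrC.
Qed.

End simple_functions.

(** * Bochner integrals *)

Section expectation.
Context (R : realType) d (T : measurableType d) (P : probability T R).
Context (D : set T) (mD : measurable D).

Lemma bsm_RintegralD (f g : T -> R) :
  bsm (f : T -> R^o) -> bsm (g : T -> R^o) ->
  \int[P]_(x in D) (f x + g x) = \int[P]_(x in D) f x + \int[P]_(x in D) g x.
Proof. by move=> bf bg; rewrite RintegralD//; exact: bsm_integrable. Qed.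

Lemma bsm_RintegralZl (f : T -> R) (r : R) : bsm (f : T -> R^o) ->
  \int[P]_(x in D) (r * f x) = r * \int[P]_(x in D) f x.
Proof. by move=> bf; rewrite RintegralZl//; exact: bsm_integrable. Qed.

Lemma bsm_le_Rintegral (f g : T -> R) :
  bsm (f : T -> R^o) -> bsm (g : T -> R^o) ->
  (forall x, D x -> f x <= g x) ->
  \int[P]_(x in D) f x <= \int[P]_(x in D) g x.
Proof.
by move=> bf bg fg; apply: le_Rintegral => //; exact: bsm_integrable.
Qed.

Lemma bsm_Rintegral_sum (I : Type) (s : seq I) (F : I -> T -> R) :
  (forall i, bsm (F i : T -> R^o)) ->
  \int[P]_(x in D) (\sum_(i <- s) F i x) = \sum_(i <- s) \int[P]_(x in D) F i x.
Proof.
move=> bF; elim: s => [|i s IHs].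
  under eq_Rintegral do rewrite big_nil.
  by rewrite big_nil Rintegral_cst// mul0r.
under eq_Rintegral do rewrite big_cons.
rewrite big_cons bsm_RintegralD// ?IHs//.
exact: (@bsm_sum R _ T R^o).
Qed.

Lemma bsm_mulr (f g : T -> R) :
  bsm (f : T -> R^o) -> bsm (g : T -> R^o) -> bsm (fun x => f x * g x : R^o).
Proof. exact: (@bsmZ _ _ _ R^o). Qed.

Lemma bsm_addr (f g : T -> R) :
  bsm (f : T -> R^o) -> bsm (g : T -> R^o) -> bsm (fun x => f x + g x : R^o).
Proof. exact: (@bsmD _ _ _ R^o). Qed.

Lemma bsm_norm_sqr (W : normedModType R) (f : T -> W) :
  bsm f -> bsm (fun x => `|f x| ^+ 2 : R^o).
Proof. by move=> bf; apply: bsm_mulr; exact: bsm_norm. Qed.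

End expectation.

Lemma inner_product_mul (R : realType) : inner_product (fun x y : R^o => x * y : R).
Proof.
split=> [u v|a u v w|u]; first exact: mulrC.
  by rewrite mulrDl -mulrA.
by rewrite /= real_normK ?num_real// expr2.
Qed.

Section bochner_theory.
Context (R : realType) d (T : measurableType d) (P : probability T R).
Context (D : set T) (mD : measurable D).
Context (W : completeNormedModType R) (dot : W -> W -> R).
Context (dotP : inner_product dot).

Lemma bsm_vsimple_approx (f : T -> W) : bsm f ->
  exists (B : R) (s : nat -> seq (set T * W)),
    [/\ forall n, measurable_pieces (s n), forall n x, `|vsimple_fun (s n) x| <= B
      & forall x, vsimple_fun (s n) x @[n --> \oo] --> f x].
Proof.
move=> [B [g [gf gB gc]]].
have [s sP] := choice (fun n => finite_valued_vsimple (gf n)).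
have sg n : vsimple_fun (s n) = g n by case: (sP n).
exists B, s; split=> [n|n x|x]; first by case: (sP n).
  by rewrite sg.
by under eq_fun do rewrite sg; exact: gc.
Qed.

Lemma bsm_norm_integral_cvg0 (B : R) (g : nat -> T -> W) (f : T -> W) :
  (forall n, bsm (g n)) -> bsm f -> (forall n x, `|g n x| <= B) ->
  (forall x, g n x @[n --> \oo] --> f x) ->
  (\int[P]_(x in D) `|f x - g n x|) @[n --> \oo] --> (0 : R).
Proof.
move=> bg bf gB gc; have [B' fB] := bsm_bounded bf.
rewrite -[0](mul0r (fine (P D))) -(Rintegral_cst P mD).
apply: (@bsm_integral_cvg _ _ _ P D mD (B' + B)).
- by move=> n; exact/bsm_norm/bsmB.
- move=> n x; rewrite normr_id.
  by apply: le_trans (ler_normB _ _) (lerD _ _).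
move=> x; rewrite -(@normr0 _ W) -(subrr (f x)); apply: cvg_norm.
by apply: cvgB => //; exact: cvg_cst.
Qed.

(** The integrals of approximating simple functions form a Cauchy sequence,
    since a weak mean is bounded by the integral of the norm. *)
Lemma bochner_exists (f : T -> W) : bsm f -> exists I, is_bochner P D f I.
Proof.
move=> bf; have [B [s [ms sB sc]]] := bsm_vsimple_approx bf.
pose e n := \int[P]_(x in D) `|f x - vsimple_fun (s n) x|.
have bs n : bsm (vsimple_fun (s n)) by exact: bsm_vsimple.
have e0 : e n @[n --> \oo] --> 0 by exact: bsm_norm_integral_cvg0 sc.
have bd n : bsm (fun x => `|f x - vsimple_fun (s n) x| : R^o).
  by apply/bsm_norm/bsmB.
have Id n m : `|vsimple_int P D (s n) - vsimple_int P D (s m)| <= e n + e m.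
  have := weak_meanB mD dotP (bs n) (bs m) (weak_mean_vsimple P mD dotP (ms n))
    (weak_mean_vsimple P mD dotP (ms m)).
  move=> /(weak_mean_norm_le mD dotP (bsmB (bs n) (bs m))) h.
  apply: le_trans h _; rewrite -bsm_RintegralD//.
  apply: bsm_le_Rintegral => //; first exact/bsm_norm/bsmB.
    exact: bsm_addr.
  move=> x _; rewrite [leRHS]addrC.
  have -> : vsimple_fun (s n) x - vsimple_fun (s m) x =
      (f x - vsimple_fun (s m) x) - (f x - vsimple_fun (s n) x).
    by rewrite opprB [RHS]addrC addrA subrK.
  exact: ler_normB.
have Ic : cvgn (fun n => vsimple_int P D (s n)).
  apply: cauchy_cvg; apply: cauchy_exP => eps eps0.
  have [N _ NP] : \forall n \near \oo, e n < eps / 2.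
    by apply: (cvgr_lt _ e0); rewrite divr_gt0.
  exists (vsimple_int P D (s N)).
  suff : \forall n \near \oo,
    ball (vsimple_int P D (s N)) eps (vsimple_int P D (s n)) by [].
  exists N => // n /= Nn.
  rewrite -ball_normE/= (le_lt_trans (Id N n))// [ltRHS]splitr ltrD//.
    exact: (NP N (leqnn N)).
  exact: (NP n Nn).
exists (lim (vsimple_int P D (s n) @[n --> \oo])), s; split=> //.
- move=> n p ps; have mp : measurable p.1 := ms n p ps.
  split=> //; rewrite (le_lt_trans (probability_le1 P _)) ?ltry//.
  exact: measurableI.
- by move=> n; exact: measurable_funTS (bsm_measurable (bd n)).
- under eq_fun do rewrite bsm_integralE//.
  by apply/fine_cvgP; split; [exact: nearW|exact: e0].
Qed.

(** Tested against [v], both sides are the limit of the integrals of the simple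
    functions. This identifies the integral independently of the sequence that
    defines it. *)
Lemma is_bochner_weak_mean (f : T -> W) I :
  bsm f -> is_bochner P D f I -> weak_mean P D dot f I.
Proof.
move=> bf [s [sm _ s0 sI]] v.
have ms n : measurable_pieces (s n) by move=> p /sm[].
have bs n : bsm (vsimple_fun (s n)) by exact: bsm_vsimple.
have e0 : (\int[P]_(x in D) `|f x - vsimple_fun (s n) x|) @[n --> \oo] --> (0 : R).
  exact: (fine_cvg s0).
have h1 : dot (vsimple_int P D (s n)) v @[n --> \oo] --> dot I v.
  by apply: (cvg_ip dotP) => //; exact: cvg_cst.
have h2 : dot (vsimple_int P D (s n)) v @[n --> \oo] -->
    \int[P]_(x in D) dot (f x) v.
  apply: (@cvg_dist _ R^o _ _
    (fun n => `|v| * \int[P]_(x in D) `|f x - vsimple_fun (s n) x|)).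
    by move=> n; apply: weak_mean_dist => //; exact: weak_mean_vsimple.
  by rewrite -[0](mulr0 `|v|); apply: cvgM => //; exact: cvg_cst.
exact: (cvg_unique _ h1 h2).
Qed.

Lemma eq_is_bochner (f f' : T -> W) I :
  (forall x, D x -> f x = f' x) -> is_bochner P D f I -> is_bochner P D f' I.
Proof.
move=> ff' [s [h1 h2 h3 h4]]; exists s; split=> //.
  move=> n; apply: eq_measurable_fun (h2 n) => x /set_mem Dx.
  by rewrite ff'.
rewrite (_ : (fun _ => _) =
  (fun n => (\int[P]_(x in D) `|f x - vsimple_fun (s n) x|%:E)%E))//.
by apply/funext => n; apply: eq_integral => x /set_mem Dx; rewrite ff'.
Qed.

(** Data of the problem are controlled on [D] only: [f] extends [f'] from [D] to
    a map that is strongly measurable everywhere. *)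
Lemma bochner_weak_mean (f f' : T -> W) : bsm f ->
  (forall x, D x -> f x = f' x) -> weak_mean P D dot f (bochner P D f').
Proof.
move=> bf ff'; apply: is_bochner_weak_mean => //.
rewrite /bochner; case: xgetP => [I _ h|].
  by apply: eq_is_bochner h => x Dx; rewrite ff'.
have [I fI] := bochner_exists bf.
by move=> /(_ I) []; exact: eq_is_bochner fI.
Qed.

Lemma weak_mean_vsimple_cvg (B : R) (s : nat -> seq (set T * W)) f m :
  (forall n, measurable_pieces (s n)) -> bsm f -> (forall n x, `|vsimple_fun (s n) x| <= B) ->
  (forall x, vsimple_fun (s n) x @[n --> \oo] --> f x) ->
  weak_mean P D dot f m -> vsimple_int P D (s n) @[n --> \oo] --> m.
Proof.
move=> ms bf sB sc fm; have bs n : bsm (vsimple_fun (s n)) by exact: bsm_vsimple.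
apply: (@cvg_dist _ _ _ _ (fun n => \int[P]_(x in D) `|f x - vsimple_fun (s n) x|)).
  move=> n; rewrite distrC; apply: (weak_mean_norm_le mD dotP (bsmB _ _)) => //.
  by apply: weak_meanB => //; exact: weak_mean_vsimple.
exact: bsm_norm_integral_cvg0 sc.
Qed.

End bochner_theory.

(** * Independent samples *)

Section change_of_variables.
Context (R : realType) d (T : measurableType d).
Context d1 (T1 : measurableType d1) (P1 : probability T1 R).
Context d2 (T2 : measurableType d2) (P2 : probability T2 R).
Context (D1 : set T1) (mD1 : measurable D1) (D2 : set T2) (mD2 : measurable D2).
Context (phi1 : T1 -> T) (mphi1 : measurable_fun setT phi1).
Context (phi2 : T2 -> T) (mphi2 : measurable_fun setT phi2).

(** The hypothesis on sets extends linearly to simple functions and then to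
    their bounded limits. For [k = 1] this is the law of a sample; for [k] the
    probability of the event [D1] it expresses independence from that event. *)
Lemma bsm_transfer (k : R) (f : T -> R) :
  (forall C, measurable C ->
     fine (P1 (D1 `&` phi1 @^-1` C)) = k * fine (P2 (D2 `&` phi2 @^-1` C))) ->
  bsm (f : T -> R^o) ->
  \int[P1]_(x in D1) f (phi1 x) = k * \int[P2]_(x in D2) f (phi2 x).
Proof.
move=> Pk bf; have [B [s [ms sB sc]]] := bsm_vsimple_approx bf.
have bs n : bsm (vsimple_fun (s n)) by exact: bsm_vsimple.
have eqs (t : seq (set T * R^o)) : measurable_pieces t ->
    \int[P1]_(x in D1) (vsimple_fun t (phi1 x) : R) =
    k * \int[P2]_(x in D2) (vsimple_fun t (phi2 x) : R).
  elim: t => [_|p t IHt /measurable_pieces_cons[mp mt]].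
    have v0 : vsimple_fun [::] = fun _ : T => 0 : R^o.
      by apply/funext => x; rewrite /vsimple_fun big_nil.
    by rewrite v0 !Rintegral_cst// !mul0r mulr0.
  have vE x : vsimple_fun (p :: t) x = (p.2 : R) * \1_(p.1) x + vsimple_fun t x :> R.
    by rewrite /vsimple_fun big_cons /= mulrC.
  have bt : bsm (vsimple_fun t) by exact: bsm_vsimple.
  have bt1 : bsm (vsimple_fun t \o phi1) by exact: bsm_precomp.
  have bt2 : bsm (vsimple_fun t \o phi2) by exact: bsm_precomp.
  have bi : bsm (\1_(p.1) : T -> R^o) by exact: bsm_indic.
  have bi1 : bsm ((\1_(p.1) : T -> R^o) \o phi1) by exact: bsm_precomp.
  have bi2 : bsm ((\1_(p.1) : T -> R^o) \o phi2) by exact: bsm_precomp.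
  have m1 : measurable (phi1 @^-1` p.1).
    by rewrite -[X in measurable X]setTI; exact: mphi1.
  have m2 : measurable (phi2 @^-1` p.1).
    by rewrite -[X in measurable X]setTI; exact: mphi2.
  under eq_Rintegral do rewrite vE.
  under [in RHS]eq_Rintegral do rewrite vE.
  rewrite !bsm_RintegralD//; last 2 first.
  - by apply: bsm_mulr => //; exact: bsm_cst.
  - by apply: bsm_mulr => //; exact: bsm_cst.
  rewrite mulrDr -IHt//; congr (_ + _).
  rewrite !bsm_RintegralZl// mulrCA; congr (_ * _).
  rewrite (_ : \int[P1]_(x in D1) _ = fine (P1 (D1 `&` phi1 @^-1` p.1))); last first.
    by rewrite setIC -integral_indic.
  rewrite (_ : \int[P2]_(x in D2) _ = fine (P2 (D2 `&` phi2 @^-1` p.1))); last first.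
    by rewrite setIC -integral_indic.
  exact: Pk.
have c1 : \int[P1]_(x in D1) (vsimple_fun (s n) (phi1 x) : R) @[n --> \oo] -->
    \int[P1]_(x in D1) f (phi1 x).
  by apply: (@bsm_integral_cvg _ _ _ P1 D1 mD1 B) => // n; exact: (bsm_precomp mphi1).
have c2 : \int[P2]_(x in D2) (vsimple_fun (s n) (phi2 x) : R) @[n --> \oo] -->
    \int[P2]_(x in D2) f (phi2 x).
  by apply: (@bsm_integral_cvg _ _ _ P2 D2 mD2 B) => // n; exact: (bsm_precomp mphi2).
have c3 : k * \int[P2]_(x in D2) (vsimple_fun (s n) (phi2 x) : R) @[n --> \oo] -->
    k * \int[P2]_(x in D2) f (phi2 x).
  by apply: cvgM => //; exact: cvg_cst.
have e12 : (fun n => \int[P1]_(x in D1) (vsimple_fun (s n) (phi1 x) : R)) =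
    (fun n => k * \int[P2]_(x in D2) (vsimple_fun (s n) (phi2 x) : R)).
  by apply/funext => n; exact: eqs.
by move: c1; rewrite e12 => c1; exact: (cvg_unique _ c1 c3).
Qed.

End change_of_variables.

Section independence.
Context (R : realType) d (T : measurableType d) (Q : probability T R).
Context (D : set T) (mD : measurable D).
Context d' (Om : measurableType d') (P : probability Om R).
Context (xi1 xi2 : Om -> T) (mxi1 : measurable_fun setT xi1)
  (mxi2 : measurable_fun setT xi2).
Context (W : completeNormedModType R) (dot : W -> W -> R).
Context (dotP : inner_product dot).
Context (indep : forall A B, measurable A -> measurable B ->
  fine (P (xi1 @^-1` A `&` xi2 @^-1` B)) = fine (Q (D `&` A)) * fine (Q (D `&` B))).

Let indep_vsimple (s t : seq (set T * W)) : measurable_pieces s -> measurable_pieces t ->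
  \int[P]_om dot (vsimple_fun s (xi1 om)) (vsimple_fun t (xi2 om)) =
  dot (vsimple_int Q D s) (vsimple_int Q D t).
Proof.
move=> ms mt.
have bt : bsm (vsimple_fun t \o xi2) by exact/bsm_precomp/bsm_vsimple.
have pre1 A : measurable A -> bsm (fun om => \1_A (xi1 om) : R^o).
  by move=> mA; apply: (bsm_precomp mxi1 (bsm_indic R mA)).
have pre2 A : measurable A -> bsm (fun om => \1_A (xi2 om) : R^o).
  by move=> mA; apply: (bsm_precomp mxi2 (bsm_indic R mA)).
have one A c : measurable A -> forall r, measurable_pieces r ->
    \int[P]_om dot (\1_A (xi1 om) *: c) (vsimple_fun r (xi2 om)) =
    dot (fine (Q (D `&` A)) *: c) (vsimple_int Q D r).
  move=> mA; elim=> [_|p r IHr /measurable_pieces_cons[mp mr]].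
    under eq_Rintegral do rewrite /vsimple_fun big_nil (ip_sym dotP) (ip_0l dotP).
    by rewrite Rintegral_cst// mul0r /vsimple_int big_nil (ip_sym dotP) (ip_0l dotP).
  have br : bsm (vsimple_fun r \o xi2) by exact/bsm_precomp/bsm_vsimple.
  have bA : bsm (fun om => \1_A (xi1 om) *: c).
    by apply: bsmZ; [exact: pre1|exact: bsm_cst].
  under eq_Rintegral do rewrite /vsimple_fun big_cons (ip_Dr dotP).
  rewrite bsm_RintegralD//; last 2 first.
  - apply: bsm_ip => //; apply: bsmZ; [exact: pre2|exact: bsm_cst].
  - exact: bsm_ip.
  rewrite /vsimple_int big_cons (ip_Dr dotP) -IHr//; congr (_ + _).
  under eq_Rintegral do rewrite (ip_Zl dotP) (ip_Zr dotP) mulrA mulrC.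
  rewrite bsm_RintegralZl//; last by apply: bsm_mulr; [exact: pre1|exact: pre2].
  rewrite (ip_Zl dotP) (ip_Zr dotP) mulrA -indep// [RHS]mulrC; congr (_ * _).
  have mAB : measurable (xi1 @^-1` A `&` xi2 @^-1` p.1).
    apply: measurableI; rewrite -[X in measurable X]setTI;
      [exact: mxi1|exact: mxi2].
  have := integral_indic P measurableT mAB; rewrite setIT => /(congr1 fine) <-.
  apply: eq_Rintegral => om _.
  by rewrite indicI.
elim: s ms => [_|p s IHs /measurable_pieces_cons[mp ms]].
  under eq_Rintegral do rewrite /vsimple_fun big_nil (ip_0l dotP).
  by rewrite Rintegral_cst// mul0r /vsimple_int big_nil (ip_0l dotP).
have bs : bsm (vsimple_fun s \o xi1) by exact/bsm_precomp/bsm_vsimple.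
under eq_Rintegral do rewrite {1}/vsimple_fun big_cons (ip_Dl dotP).
rewrite bsm_RintegralD//; last 2 first.
- apply: bsm_ip => //; apply: bsmZ; [exact: pre1|exact: bsm_cst].
- exact: bsm_ip.
by rewrite {1}/vsimple_int big_cons (ip_Dl dotP) -IHs// one.
Qed.

(** On simple functions both sides expand into the same finite sum of products
    of probabilities. *)
Lemma independent_expectation (f1 f2 : T -> W) m1 m2 :
  bsm f1 -> bsm f2 -> weak_mean Q D dot f1 m1 -> weak_mean Q D dot f2 m2 ->
  \int[P]_om dot (f1 (xi1 om)) (f2 (xi2 om)) = dot m1 m2.
Proof.
move=> b1 b2 fm1 fm2.
have [B1 [s1 [ms1 sB1 sc1]]] := bsm_vsimple_approx b1.
have [B2 [s2 [ms2 sB2 sc2]]] := bsm_vsimple_approx b2.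
have c1 : dot (vsimple_int Q D (s1 n)) (vsimple_int Q D (s2 n)) @[n --> \oo] -->
    dot m1 m2.
  apply: cvg_ip => //.
    exact: (weak_mean_vsimple_cvg mD dotP ms1 b1 sB1).
  exact: (weak_mean_vsimple_cvg mD dotP ms2 b2 sB2).
have c2 : \int[P]_om dot (vsimple_fun (s1 n) (xi1 om)) (vsimple_fun (s2 n) (xi2 om))
    @[n --> \oo] --> \int[P]_om dot (f1 (xi1 om)) (f2 (xi2 om)).
  apply: (@bsm_integral_cvg _ _ _ P setT measurableT (B1 * B2)).
  - by move=> n; apply: bsm_ip => //; apply: (bsm_precomp _ (bsm_vsimple _)).
  - by move=> n om; rewrite (le_trans (cauchy_schwarz dotP _ _))// ler_pM.
  - by move=> om; exact: cvg_ip.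
have e12 : (fun n => dot (vsimple_int Q D (s1 n)) (vsimple_int Q D (s2 n))) =
    (fun n => \int[P]_om dot (vsimple_fun (s1 n) (xi1 om))
                             (vsimple_fun (s2 n) (xi2 om))).
  by apply/funext => n; rewrite indep_vsimple.
by move: c1; rewrite e12 => c1; exact: (cvg_unique _ c2 c1).
Qed.

End independence.

Section variance.
Context (R : realType) d (T : measurableType d) (Q : probability T R).
Context (D : set T) (mD : measurable D) (QD : Q D = 1%E).
Context (W : completeNormedModType R) (dot : W -> W -> R).
Context (dotP : inner_product dot).

Lemma weak_mean_cst (w : W) : weak_mean Q D dot (fun=> w) w.
Proof. by move=> v; rewrite Rintegral_cst// [X in fine X]QD mulr1. Qed.

Lemma variance_eq (f : T -> W) m : bsm f -> weak_mean Q D dot f m ->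
  \int[Q]_(x in D) `|f x - m| ^+ 2 = \int[Q]_(x in D) `|f x| ^+ 2 - `|m| ^+ 2.
Proof.
move=> bf fm.
have bm : bsm (fun x => dot (f x) m : R^o) by apply: bsm_ip => //; exact: bsm_cst.
have -> : \int[Q]_(x in D) `|f x - m| ^+ 2 =
    \int[Q]_(x in D) `|f x| ^+ 2 + \int[Q]_(x in D) (- 2 * dot (f x) m + `|m| ^+ 2).
  rewrite -bsm_RintegralD//; last 2 first.
  - exact: bsm_norm_sqr.
  - apply: bsm_addr; last exact: bsm_cst.
    by apply: bsm_mulr => //; exact: bsm_cst.
  apply: eq_Rintegral => x _; rewrite -!(ip_norm dotP).
  rewrite (ip_Bl dotP) !(ip_Br dotP) (ip_sym dotP m (f x)); ring.
congr (_ + _); rewrite bsm_RintegralD//; last 2 first.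
- by apply: bsm_mulr => //; exact: bsm_cst.
- exact: bsm_cst.
rewrite bsm_RintegralZl// -fm Rintegral_cst// [X in fine X]QD mulr1 (ip_norm dotP).
ring.
Qed.

Lemma variance_le (f : T -> W) m : bsm f -> weak_mean Q D dot f m ->
  \int[Q]_(x in D) `|f x - m| ^+ 2 <= \int[Q]_(x in D) `|f x| ^+ 2.
Proof. by move=> bf fm; rewrite variance_eq// gerBl sqr_ge0. Qed.

Lemma mean_sqr_le (f : T -> W) m : bsm f -> weak_mean Q D dot f m ->
  `|m| ^+ 2 <= \int[Q]_(x in D) `|f x| ^+ 2.
Proof.
move=> bf fm; rewrite -subr_ge0 -variance_eq//.
by apply: Rintegral_ge0 => x _; rewrite sqr_ge0.
Qed.

Context d' (Om : measurableType d') (P : probability Om R).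

(** Pairwise independence makes the cross terms of the expanded square vanish,
    and every diagonal term is a variance. *)
Lemma mean_square_sum_le (J : eqType) (xi : J -> Om -> T) (s : seq J)
    (w : J -> R) (G : J -> T -> W) (m : J -> W) :
  uniq s -> (forall i, measurable_fun setT (xi i)) ->
  (forall i C, measurable C -> fine (P (xi i @^-1` C)) = fine (Q (D `&` C))) ->
  (forall i j A B, i != j -> measurable A -> measurable B ->
     fine (P (xi i @^-1` A `&` xi j @^-1` B)) =
     fine (Q (D `&` A)) * fine (Q (D `&` B))) ->
  (forall i, bsm (G i)) -> (forall i, weak_mean Q D dot (G i) (m i)) ->
  \int[P]_om `|\sum_(i <- s) w i *: (G i (xi i om) - m i)| ^+ 2 <=
  \sum_(i <- s) w i ^+ 2 * \int[Q]_(x in D) `|G i x| ^+ 2.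
Proof.
move=> us mxi law indep bG Gm.
pose c i x := G i x - m i.
have bc i : bsm (c i) by apply: bsmB => //; exact: bsm_cst.
have cm i : weak_mean Q D dot (c i) 0.
  rewrite -(subrr (m i)); apply: weak_meanB => //; first exact: bsm_cst.
  exact: weak_mean_cst.
have bcx i : bsm (fun om => c i (xi i om)) by exact: (bsm_precomp (mxi i)).
have bwc i : bsm (fun om => w i *: c i (xi i om)).
  by apply: bsmZ => //; exact: bsm_cst.
elim: s us => [_|i s IHs /= /andP[nis us]].
  under eq_Rintegral do rewrite big_nil normr0 expr0n/=.
  by rewrite big_nil Rintegral_cst// mul0r.
have bS : bsm (fun om => \sum_(j <- s) w j *: c j (xi j om)).
  exact: (bsm_sum s bwc).
have -> : \int[P]_om `|\sum_(j <- i :: s) w j *: (G j (xi j om) - m j)| ^+ 2 =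
    \int[P]_om (w i ^+ 2 * `|c i (xi i om)| ^+ 2) +
    (\int[P]_om (\sum_(j <- s) 2 * (w i * w j) * dot (c i (xi i om)) (c j (xi j om))) +
    \int[P]_om (`|\sum_(j <- s) w j *: c j (xi j om)| ^+ 2)).
  have bcross j : bsm (fun om => 2 * (w i * w j) *
      dot (c i (xi i om)) (c j (xi j om)) : R^o).
    by apply: bsm_mulr; [exact: bsm_cst|exact: bsm_ip].
  have bsum : bsm (fun om => \sum_(j <- s) 2 * (w i * w j) *
      dot (c i (xi i om)) (c j (xi j om)) : R^o).
    exact: (@bsm_sum R _ _ R^o).
  rewrite -bsm_RintegralD//; last exact: bsm_norm_sqr.
  rewrite -bsm_RintegralD//; last 2 first.
  - by apply: bsm_mulr; [exact: bsm_cst|exact: bsm_norm_sqr].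
  - by apply: bsm_addr => //; exact: bsm_norm_sqr.
  apply: eq_Rintegral => om _; rewrite big_cons -/(c i (xi i om)).
  under eq_bigr do rewrite -/(c _ (xi _ om)).
  move: (c i (xi i om)) => a; set S := \sum_(j <- s) _ *: _.
  rewrite -!(ip_norm dotP) (ip_Dl dotP) !(ip_Dr dotP) (ip_sym dotP S).
  rewrite !(ip_Zl dotP) (ip_Zr dotP).
  have -> : \sum_(j <- s) 2 * (w i * w j) * dot a (c j (xi j om)) =
      2 * (w i * dot a S).
    rewrite (ip_sym dotP a S) /S (ip_suml dotP) !mulr_sumr.
    by apply: eq_bigr => j _; rewrite (ip_Zl dotP) (ip_sym dotP a); ring.
  ring.
rewrite big_cons lerD//.
  rewrite bsm_RintegralZl//; last exact: bsm_norm_sqr.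
  rewrite ler_wpM2l ?sqr_ge0//.
  have -> : \int[P]_om `|c i (xi i om)| ^+ 2 = 1 * \int[Q]_(x in D) `|c i x| ^+ 2.
    apply: (bsm_transfer measurableT mD (mxi i) (@measurable_id _ T setT)
      (f := fun x => `|c i x| ^+ 2)).
      by move=> C mC; rewrite setTI mul1r law.
    exact: bsm_norm_sqr.
  by rewrite mul1r; exact: variance_le.
rewrite (_ : \int[P]_om (\sum_(j <- s) _) = 0) ?add0r; first exact: IHs.
rewrite bsm_Rintegral_sum//; last first.
  by move=> j; apply: bsm_mulr; [exact: bsm_cst|exact: bsm_ip].
rewrite big_seq big1// => j js.
rewrite bsm_RintegralZl//; last exact: bsm_ip.
have ij : i != j by apply: contraNneq nis => ->.
rewrite (independent_expectation mD (mxi i) (mxi j) dotP _ (bc i) (bc j) (cm i) (cm j)).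
  by rewrite (ip_0l dotP) mulr0.
by move=> A B mA mB; exact: indep.
Qed.

End variance.

(** * Rounding in the box of parameters *)

Section grid.
Context (R : realType).

Definition clampR (x : R) : R := Num.max (-1) (Num.min 1 x).

(** The retraction onto the box turns maps that are controlled on the box into
    maps that are controlled everywhere. *)
Definition clamp (z : rseq R) : rseq R := fun j => clampR (z j).

Lemma clampR_itv x : -1 <= clampR x <= 1.
Proof. by rewrite /clampR le_max lexx /= ge_max ltW ?ltN11//= ge_min lexx. Qed.

Lemma clamp_box z : box R (clamp z).
Proof. by move=> j; exact: clampR_itv. Qed.

Lemma clamp_id z : box R z -> clamp z = z.
Proof.
move=> zb; apply/funext => j; have /andP[z1 z2] := zb j.
by rewrite /clamp /clampR (min_idPr z2) (max_idPr z1).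
Qed.

Definition cell (n : nat) (x : R) : nat := Num.truncn ((clampR x + 1) * n.+1%:R).

Lemma cell_arg_ge0 n x : 0 <= (clampR x + 1) * n.+1%:R.
Proof. by rewrite mulr_ge0// -lerBlDr sub0r; case/andP: (clampR_itv x). Qed.

Lemma cell_lt n x : (cell n x < (2 * n.+1).+1)%N.
Proof.
have /andP[h _] := truncn_itv (cell_arg_ge0 n x).
rewrite ltnS -(ler_nat R) (le_trans h)// natrM ler_wpM2r//.
by rewrite -lerBrDr; case/andP: (clampR_itv x); lra.
Qed.

Definition grid_point (n : nat) (k : nat) : R := k%:R / n.+1%:R - 1.

Lemma grid_point_itv n k : (k < (2 * n.+1).+1)%N -> -1 <= grid_point n k <= 1.
Proof.
rewrite ltnS -(ler_nat R) natrM => h; rewrite /grid_point.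
have n0 : 0 < n.+1%:R :> R by rewrite ltr0n.
rewrite lerDr divr_ge0//= lerBlDr ler_pdivrMr//.
Qed.

Lemma grid_point_dist n x : `|grid_point n (cell n x) - clampR x| <= n.+1%:R^-1.
Proof.
have /andP[h1 h2] := truncn_itv (cell_arg_ge0 n x).
have n0 : 0 < n.+1%:R :> R by rewrite ltr0n.
rewrite /grid_point /cell; move: h1 h2.
set k := Num.truncn _; set m : R := n.+1%:R in n0 *; rewrite -natr1.
rewrite -ler_pdivrMr// => h1; rewrite -ltr_pdivlMr// mulrDl mul1r => h2.
have mV : 0 < m^-1 by rewrite invr_gt0.
move: (k%:R / m) (m^-1) (clampR x) h1 h2 mV => a b c h1 h2 mV.
by rewrite ler_norml; apply/andP; split; lra.
Qed.

(** Rounding the first [n] coordinates to a grid of mesh [1 / n.+1] and setting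
    the others to 0 leaves finitely many values, yet converges coordinatewise
    on the box. A map that is continuous on the box is thus a limit of simple
    maps. *)
Definition rnd (n : nat) (z : rseq R) : rseq R :=
  fun j => if (j < n)%N then grid_point n (cell n (z j)) else 0.

Lemma rnd_box n z : box R (rnd n z).
Proof.
move=> j; rewrite /rnd; case: ifP => _; first exact/grid_point_itv/cell_lt.
by rewrite lerN10 ler01.
Qed.

Lemma measurable_cell n (k : nat) :
  measurable ([set x : measurableTypeR R | cell n x = k]).
Proof.
pose g (x : measurableTypeR R) : R := (clampR x + 1) * n.+1%:R.
rewrite (_ : [set _ | _] = g @^-1` `[k%:R, k.+1%:R[%classic).
  have mg : measurable_fun setT g.
    apply: measurable_funM; last exact: measurable_cst.
    apply: measurable_funD; last exact: measurable_cst.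
    apply: (measurable_maxr (@measurable_cst _ _ _ _ setT (-1 : R))).
    apply: (@measurable_minr _ _ _ _ (cst 1) id); first exact: measurable_cst.
    exact: measurable_id.
  by rewrite -[X in measurable X]setTI; apply: mg => //; exact: measurable_itv.
apply/seteqP; split=> x /=; rewrite in_itv/=.
  by move=> <-; exact: (truncn_itv (cell_arg_ge0 n x)).
by move=> h; apply/eqP; rewrite /cell truncn_eq// cell_arg_ge0.
Qed.

Lemma measurable_coord (j : nat) :
  measurable_fun setT (fun z : rseq R => z j : measurableTypeR R).
Proof.
move=> _ A mA; rewrite setTI; apply: sub_sigma_algebra.
by exists j, A.
Qed.

Lemma finite_valued_rnd n : finite_valued (rnd n).
Proof.
pose i (z : rseq R) : {ffun 'I_n -> 'I_(2 * n.+1).+1} :=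
  [ffun j : 'I_n => inord (cell n (z j))].
pose c (k : {ffun 'I_n -> 'I_(2 * n.+1).+1}) : rseq R :=
  fun j => if insub j is Some j' then grid_point n (k j') else 0.
exists {ffun 'I_n -> 'I_(2 * n.+1).+1}, i, c; split=> [k|].
  rewrite (_ : _ @^-1` _ =
    \bigcap_(j in [set: 'I_n]) [set z : rseq R | cell n (z j) = k j]).
    apply: fin_bigcap_measurable => [|j _]; first exact: finite_finset.
    have := @measurable_coord j measurableT _ (measurable_cell n (k j)).
    by rewrite setTI.
  apply/seteqP; split=> z /=.
    by move=> <- j _ /=; rewrite ffunE inordK// cell_lt.
  move=> h; apply/ffunP => j; rewrite ffunE; apply: val_inj => /=.
  by rewrite inordK ?cell_lt// (h j).
apply/funext => z; apply/funext => j; rewrite /rnd /c /=.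
case: insubP => [j' jn jE|/negbTE ->//].
by rewrite jn ffunE inordK ?cell_lt// jE.
Qed.

Lemma rnd_cvg (z : rseq R) j : rnd n z j @[n --> \oo] --> clamp z j.
Proof.
suff : grid_point n (cell n (z j)) @[n --> \oo] --> clamp z j.
  apply: cvg_trans; apply: near_eq_cvg; near=> n.
  rewrite /rnd ifT//; near: n; exact: nbhs_infty_gt.
apply: (@cvg_dist _ R^o _ _ harmonic); last exact: cvg_harmonic.
by move=> n; exact: grid_point_dist.
Unshelve. all: by end_near. Qed.

(** Coordinatewise convergence is convergence in the product topology. *)
Lemma rnd_near (z : rseq R) (Pr : set (rseq R)) :
  (\forall x \near within (box R) (nbhs (clamp z : {ptws nat -> R})), Pr x) ->
  \forall n \near \oo, Pr (rnd n z).
Proof.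
rewrite near_withinE => nP.
have c : {ptws, (rnd n z : nat -> R) @[n --> \oo] --> (clamp z : nat -> R)}.
  by apply/pointwise_cvgP => t; exact: rnd_cvg.
near=> n; have : box R (rnd n z) -> Pr (rnd n z) by near: n; exact: (c _ nP).
by apply; exact: rnd_box.
Unshelve. all: by end_near. Qed.

Lemma bsm_clamp (W : normedModType R) (f : rseq R -> W) :
  (exists B : R, forall z, box R z -> `|f z| <= B) ->
  (forall z, f (rnd n z) @[n --> \oo] --> f (clamp z)) ->
  bsm (f \o clamp).
Proof.
move=> [B fB] fc; exists B, (fun n => f \o rnd n); split=> [n|n z|z].
- exact/finite_valued_comp/finite_valued_rnd.
- exact/fB/rnd_box.
- exact: fc.
Qed.

End grid.

(** * Galerkin solutions *)

Section galerkin.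
Context (R : realType) (V H U : hilbert R) (pb : problem V H U).

Lemma hdot_inner_product (W : hilbert R) : inner_product (hdot W).
Proof.
split=> [u v|a u v w|u]; last exact: hdot_norm.
- by rewrite hermC expr0 mul1r.
- by rewrite linearPl.
Qed.

Lemma ctrl_bound : exists2 c : R, 0 < c &
  forall u v, `|ctrl pb u v| <= c * `|u| * `|v|.
Proof.
have [c cP] := ctrl_bounded pb; exists (`|c| + 1); first by rewrite ltr_wpDl.
move=> u v; apply: le_trans (cP u v) _; rewrite -!mulrA ler_wpM2r ?mulr_ge0//.
by rewrite (le_trans (ler_norm _))// lerDl.
Qed.

Lemma emb_bound : exists2 c : R, 0 < c & forall v, `|emb pb v| <= c * `|v|.
Proof.
have := proj2 (linear_bounded_continuous (emb pb)) (@emb_continuous _ _ _ _ pb).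
move/linear_boundedP => [M [_ MP]].
exists (`|M| + 1); first by rewrite ltr_wpDl.
by apply: MP; rewrite (le_lt_trans (ler_norm M))// ltrDl.
Qed.

Lemma ctrl_adjB v w : ctrl_adj pb (v - w) = ctrl_adj pb v - ctrl_adj pb w.
Proof.
apply: (ip_nondeg (hdot_inner_product U)) => u.
by rewrite (ip_Bl (hdot_inner_product U)) !ctrl_adjP linearBr.
Qed.

Lemma ctrl_adj_bound (c : R) : 0 < c ->
  (forall u v, `|ctrl pb u v| <= c * `|u| * `|v|) ->
  forall v, `|ctrl_adj pb v| <= c * `|v|.
Proof.
move=> c0 cP v; have [->|w0] := eqVneq (ctrl_adj pb v) 0.
  by rewrite normr0 mulr_ge0// ltW.
rewrite -(@ler_pM2r _ `|ctrl_adj pb v|) ?normr_gt0// -expr2 -hdot_norm ctrl_adjP.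
by rewrite (le_trans (ler_norm _))// (le_trans (cP _ _))// mulrAC.
Qed.

(** Both the exact solutions (on the whole space) and the finite element
    solutions (on the subspaces) are pairs of this kind. *)
Definition galerkin_pair (S : set V) (u : U) (y q : rseq R -> V) :=
  [/\ forall v w, S v -> S w -> S (v - w),
      forall z, box R z -> S (y z) /\ S (q z),
      forall z v, box R z -> S v -> Defs.form pb z (y z) v = ctrl pb u v
    & forall z v, box R z -> S v ->
        Defs.form pb z v (q z) = hdot H (emb pb (y z) - target pb) (emb pb v)].

(** Coercivity, with the solution itself as test vector. *)
Lemma galerkin_state_bound (c : R) (S : set V) u y q z : 0 < c ->
  (forall u v, `|ctrl pb u v| <= c * `|u| * `|v|) ->
  galerkin_pair S u y q -> box R z -> `|y z| <= c * `|u| / amin pb.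
Proof.
move=> c0 cP [_ Syq yP _] zb; have a0 := amin_gt0 pb.
have [->|y0] := eqVneq (y z) 0.
  by rewrite normr0 divr_ge0// ?mulr_ge0// ltW.
rewrite ler_pdivlMr// -(@ler_pM2r _ `|y z|) ?normr_gt0//.
rewrite mulrAC -expr2 mulrC (le_trans (@form_coercive _ _ _ _ pb _ zb _))//.
rewrite yP//; last by case: (Syq z zb).
exact: le_trans (ler_norm _) (cP _ _).
Qed.

Lemma galerkin_adjoint_bound (c k : R) (S : set V) u y q z : 0 < c ->
  (forall v, `|emb pb v| <= c * `|v|) ->
  galerkin_pair S u y q -> box R z -> `|y z| <= k ->
  `|q z| <= (c * k + `|target pb|) * c / amin pb.
Proof.
move=> c0 cP [_ Syq _ qP] zb yk; have a0 := amin_gt0 pb.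
have k0 : 0 <= k by exact: le_trans yk.
have [->|q0] := eqVneq (q z) 0.
  by rewrite normr0 divr_ge0 ?(ltW a0)// mulr_ge0 ?(ltW c0)// addr_ge0// mulr_ge0// ltW.
rewrite ler_pdivlMr// -(@ler_pM2r _ `|q z|) ?normr_gt0//.
rewrite mulrAC -expr2 mulrC (le_trans (@form_coercive _ _ _ _ pb _ zb _))//.
rewrite qP//; last by case: (Syq z zb).
rewrite (le_trans (ler_norm _))// (le_trans (cauchy_schwarz (hdot_inner_product H) _ _))//.
rewrite -mulrA ler_pM// (le_trans (ler_normB _ _))// lerD2r.
by rewrite (le_trans (cP _))// ler_wpM2l// ltW.
Qed.

(** The difference [d] of the solutions for two parameters is an admissible test
    vector; it gives [a(d, d) = - (a - a0)(y0, d)], where the right-hand side is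
    small by continuity of the form in its parameter. *)
Lemma galerkin_state_cvg (S : set V) u y q z : galerkin_pair S u y q ->
  y (rnd n z) @[n --> \oo] --> y (clamp z).
Proof.
move=> [SB Syq yP _]; have a0 := amin_gt0 pb.
apply/cvgrPdist_le => e e0.
set y0 := y (clamp z).
pose eta := e * amin pb / (`|y0| + 1).
have y1 : 0 < `|y0| + 1 by rewrite ltr_wpDl.
have eta0 : 0 < eta by rewrite divr_gt0// mulr_gt0.
have := rnd_near (@form_continuous _ _ _ _ pb _ (clamp_box z) _ eta0).
apply: filterS => n fn; rewrite distrC; set d := y (rnd n z) - y0.
have [->|d0] := eqVneq d 0; first by rewrite normr0 ltW.
have Sd : S d.
  by apply: SB; [case: (Syq _ (rnd_box n z))|case: (Syq _ (clamp_box z))].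
rewrite -(@ler_pM2l _ (amin pb))// -(@ler_pM2r _ `|d|) ?normr_gt0//.
rewrite -mulrA -expr2 (le_trans (@form_coercive _ _ _ _ pb _ (rnd_box n z) _))//.
have -> : Defs.form pb (rnd n z) d d = - (Defs.form pb (rnd n z) y0 d - Defs.form pb (clamp z) y0 d).
  rewrite {1}/d linearBl (yP _ _ (rnd_box n z))// (yP _ _ (clamp_box z))//.
  by rewrite opprB.
rewrite (le_trans (ler_norm _))// normrN (le_trans (fn _ _))//.
rewrite ler_wpM2r// /eta mulrAC ler_pdivrMr// [amin pb * e]mulrC.
by rewrite ler_wpM2l ?lerDl// mulr_ge0// ltW.
Qed.

End galerkin.

(** * Observables of Galerkin solutions *)

Section galerkin_observables.
Context (R : realType) (V H U : hilbert R) (pb : problem V H U).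

(** As for the state, with the convergence of the state as an additional source
    term. *)
Lemma galerkin_adjoint_cvg (S : set V) u y q z : galerkin_pair pb S u y q ->
  q (rnd n z) @[n --> \oo] --> q (clamp z).
Proof.
move=> gp; have yc := galerkin_state_cvg (z := z) gp.
have [c c0 cP] := emb_bound pb.
have [SB Syq _ qP] := gp; have a0 := amin_gt0 pb.
have ip := hdot_inner_product H.
apply/cvgrPdist_le => e e0.
set y0 := y (clamp z) in yc; set q0 := q (clamp z).
pose eta := e * amin pb / 2 / (`|q0| + 1).
have q1 : 0 < `|q0| + 1 by rewrite ltr_wpDl.
have ea0 : 0 < e * amin pb / 2 by rewrite divr_gt0// mulr_gt0.
have eta0 : 0 < eta by rewrite divr_gt0.
have cc0 : 0 < c * c by rewrite mulr_gt0.
have := rnd_near (@form_continuous _ _ _ _ pb _ (clamp_box z) _ eta0).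
have kap0 : 0 < e * amin pb / 2 / (c * c) by rewrite divr_gt0.
have /cvgrPdist_le /(_ _ kap0) := yc.
apply: filterS2 => n yn fn; rewrite distrC; set d := q (rnd n z) - q0.
have [->|d0] := eqVneq d 0; first by rewrite normr0 ltW.
have Sd : S d.
  by apply: SB; [case: (Syq _ (rnd_box n z))|case: (Syq _ (clamp_box z))].
rewrite -(@ler_pM2l _ (amin pb))// -(@ler_pM2r _ `|d|) ?normr_gt0//.
rewrite -mulrA -expr2 (le_trans (@form_coercive _ _ _ _ pb _ (rnd_box n z) _))//.
have -> : Defs.form pb (rnd n z) d d =
    hdot H (emb pb (y (rnd n z) - y0)) (emb pb d) -
    (Defs.form pb (rnd n z) d q0 - Defs.form pb (clamp z) d q0).
  rewrite {2}/d linearBr (qP _ _ (rnd_box n z))// (qP _ _ (clamp_box z))//.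
  rewrite (linearB _ (y (rnd n z)) y0) -/y0 !(ip_Bl ip); ring.
rewrite (le_trans (ler_norm _))// (le_trans (ler_normB _ _))//.
have -> : amin pb * e * `|d| = e * amin pb / 2 * `|d| + e * amin pb / 2 * `|d|.
  by field.
rewrite lerD//.
  rewrite (le_trans (cauchy_schwarz ip _ _))//.
  rewrite (@le_trans _ _ ((c * `|y (rnd n z) - y0|) * (c * `|d|)))//.
    by rewrite ler_pM.
  rewrite mulrACA mulrA ler_wpM2r// -ler_pdivlMl// distrC mulrC.
  exact: yn.
rewrite (le_trans (fn _ _))// mulrAC ler_wpM2r//.
rewrite /eta mulrAC ler_pdivrMr//.
by rewrite ler_wpM2l ?lerDl// ltW.
Qed.

Lemma galerkin_pair_exact u : galerkin_pair pb setT u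
  (fun z => state pb z u) (fun z => adjoint pb z u).
Proof. by split=> // z v zb _; [exact: stateP|exact: adjointP]. Qed.

Lemma galerkin_pair_fe (dc : discretization pb) l u : (1 <= l)%N ->
  galerkin_pair pb (fe_space dc l) u
    (fun z => fe_state dc l z u) (fun z => fe_adjoint dc l z u).
Proof.
move=> l1; split.
- have [e [_ ->]] := fe_spaceP dc l1.
  move=> _ _ [a ->] [b ->]; exists (fun i => a i - b i).
  by rewrite -sumrB; apply: eq_bigr => i _; rewrite scalerBl.
- by move=> z zb; split; [exact: fe_state_in|exact: fe_adjoint_in].
- by move=> z v zb; exact: fe_stateP.
- by move=> z v zb; exact: fe_adjointP.
Qed.

Context (theta : R) (theta_gt0 : 0 < theta).

Definition weight (y : V) : R := expR (theta * misfit pb y).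

Lemma expR_lipschitz (M a b : R) : a <= M -> b <= M ->
  `|expR a - expR b| <= expR M * `|a - b|.
Proof.
wlog ba : a b / b <= a.
  move=> h aM bM; have [/h|/ltW /h] := leP b a; first exact.
  by rewrite distrC [`|a - b|]distrC; exact.
move=> aM _; rewrite !ger0_norm ?subr_ge0 ?ler_expR//.
apply: (@le_trans _ _ (expR a * (a - b))).
  have := expR_ge1Dx (b - a); rewrite -(ler_pM2l (expR_gt0 a)) -expRD.
  rewrite [a + (b - a)]addrC subrK; lra.
by rewrite ler_wpM2r ?subr_ge0// ler_expR.
Qed.

(** The constants are uniform in the control, the parameter and the subspace:
    coercivity bounds states and adjoints over the bounded set [Uad], and the
    exponential is Lipschitz on the resulting bounded range of misfits. *)
Lemma galerkin_bounds : exists KY Kq CL : R,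
  [/\ 1 <= KY, 0 < Kq, 0 < CL & forall u S y q, Uad pb u ->
     galerkin_pair pb S u y q -> forall z, box R z ->
     [/\ 1 <= weight (y z) <= KY, `|ctrl_adj pb (q z)| <= Kq
       & forall S' y' q', galerkin_pair pb S' u y' q' ->
         `|weight (y z) - weight (y' z)| <=
           CL * `|emb pb (y z) - emb pb (y' z)|]].
Proof.
have [cB cB0 cBP] := ctrl_bound pb.
have [cE cE0 cEP] := emb_bound pb.
have a0 := amin_gt0 pb.
have [Mu [Mu_ MuP]] := Uad_bounded pb.
pose m := `|Mu| + 1.
have m0 : 0 < m by rewrite ltr_wpDl.
have mP u : Uad pb u -> `|u| <= m.
  by move=> uU; apply: (MuP m) => //; rewrite (le_lt_trans (ler_norm Mu))// ltrDl.
pose ry := cB * m / amin pb.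
have ry0 : 0 < ry by rewrite divr_gt0// mulr_gt0.
pose G := cE * ry + `|target pb|.
have G0 : 0 < G by rewrite ltr_wpDr// mulr_gt0.
pose rq := G * cE / amin pb.
have rq0 : 0 < rq by rewrite divr_gt0// mulr_gt0.
pose M := theta * (2^-1 * G ^+ 2).
have M0 : 0 < M by rewrite mulr_gt0// mulr_gt0// exprn_gt0.
have yb u S y q z : Uad pb u -> galerkin_pair pb S u y q -> box R z ->
    `|y z| <= ry.
  move=> uU gp zb; apply: le_trans (galerkin_state_bound cB0 cBP gp zb) _.
  by rewrite ler_wpM2r ?invr_ge0 ?(ltW a0)// ler_wpM2l ?(ltW cB0)// mP.
have gb u S y q z : Uad pb u -> galerkin_pair pb S u y q -> box R z ->
    `|emb pb (y z) - target pb| <= G.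
  move=> uU gp zb; rewrite (le_trans (ler_normB _ _))// lerD2r.
  by rewrite (le_trans (cEP _))// ler_wpM2l ?(ltW cE0)//; exact: yb gp zb.
have tM u S y q z : Uad pb u -> galerkin_pair pb S u y q -> box R z ->
    theta * misfit pb (y z) <= M.
  move=> uU gp zb; rewrite ler_wpM2l ?(ltW theta_gt0)// ler_wpM2l//.
  by rewrite ler_sqr ?nnegrE ?(ltW G0)//; exact: gb gp zb.
exists (expR M), (cB * rq), (expR M * (theta * G)).
split; first by rewrite -expR0 ler_expR ltW.
  by rewrite mulr_gt0.
  by rewrite mulr_gt0 ?expR_gt0// mulr_gt0.
move=> u S y q uU gp z zb; split.
- rewrite ler_expR (tM _ _ _ _ _ uU gp zb) andbT -expR0 ler_expR.
  by rewrite mulr_ge0 ?(ltW theta_gt0)// mulr_ge0// exprn_ge0.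
- rewrite (le_trans (ctrl_adj_bound cB0 cBP _))// ler_wpM2l ?(ltW cB0)//.
  exact: galerkin_adjoint_bound cE0 cEP gp zb (yb _ _ _ _ _ uU gp zb).
move=> S' y' q' gp'.
have h1 := gb _ _ _ _ _ uU gp zb; have h2 := gb _ _ _ _ _ uU gp' zb.
rewrite (le_trans (expR_lipschitz (tM _ _ _ _ _ uU gp zb)
  (tM _ _ _ _ _ uU gp' zb)))// -[leRHS]mulrA ler_wpM2l ?expR_ge0//.
rewrite -mulrBr normrM gtr0_norm// -[leRHS]mulrA ler_wpM2l ?(ltW theta_gt0)//.
rewrite /misfit -mulrBr normrM gtr0_norm ?invr_gt0// subr_sqr normrM.
rewrite ler_pdivrMl// mulrC.
have -> : emb pb (y z) - emb pb (y' z) =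
    (emb pb (y z) - target pb) - (emb pb (y' z) - target pb).
  by rewrite opprB addrA subrK.
rewrite mulrA ler_pM//; last exact: ler_dist_dist.
rewrite ger0_norm ?addr_ge0//; lra.
Qed.

(** Continuity in the parameter makes the values at rounded parameters converge. *)
Lemma galerkin_bsm u S y q : Uad pb u -> galerkin_pair pb S u y q ->
  [/\ bsm (fun z => weight (y (clamp z)) : R^o),
      bsm (fun z => emb pb (y (clamp z)))
    & bsm (fun z => ctrl_adj pb (q (clamp z)))].
Proof.
move=> uU gp; have [KY [Kq [CL [_ _ _ bd]]]] := galerkin_bounds.
have [cB cB0 cBP] := ctrl_bound pb.
have [cE cE0 cEP] := emb_bound pb.
have ec z : emb pb (y (rnd n z)) @[n --> \oo] --> emb pb (y (clamp z)).
  have := galerkin_state_cvg (z := z) gp.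
  by move=> /(cvg_comp _ _); apply; exact: emb_continuous.
split.
- apply: (@bsm_clamp R R^o (fun z => weight (y z))) => [|z].
    exists KY => z zb; have [/andP[_ h] _ _] := bd _ _ _ _ uU gp _ zb.
    by rewrite ger0_norm ?expR_ge0.
  have nc : `|emb pb (y (rnd n z)) - target pb| @[n --> \oo] -->
      `|emb pb (y (clamp z)) - target pb|.
    by apply: cvg_norm; apply: cvgB => //; exact: cvg_cst.
  have mc : theta * misfit pb (y (rnd n z)) @[n --> \oo] -->
      theta * misfit pb (y (clamp z)).
    rewrite /misfit; apply: cvgM; first exact: cvg_cst.
    apply: cvgM; first exact: cvg_cst.
    by rewrite expr2; under eq_fun do rewrite expr2; exact: cvgM.
  exact: (cvg_comp _ _ mc (@continuous_expR R _)).
- apply: (@bsm_clamp R _ (fun z => emb pb (y z))) => [|z]; last exact: ec.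
  exists (cE * (cB * `|u| / amin pb)) => z zb.
  rewrite (le_trans (cEP _))// ler_wpM2l ?(ltW cE0)//.
  exact: galerkin_state_bound cB0 cBP gp zb.
- apply: (@bsm_clamp R _ (fun z => ctrl_adj pb (q z))) => [|z].
    by exists Kq => z zb; have [_ h _] := bd _ _ _ _ uU gp _ zb.
  apply: (@cvg_dist _ _ _ _ (fun n => cB * `|q (rnd n z) - q (clamp z)|)).
    by move=> n; rewrite -ctrl_adjB; exact: ctrl_adj_bound.
  rewrite -[0](mulr0 cB); apply: cvgM; first exact: cvg_cst.
  rewrite -(@normr0 _ V) -(subrr (q (clamp z))); apply: cvg_norm.
  by apply: cvgB; [exact: galerkin_adjoint_cvg gp|exact: cvg_cst].
Qed.

End galerkin_observables.

(** * Geometric mesh widths *)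

Lemma powR_add (R : realType) (x s t : R) : 0 < x -> x `^ (s + t) = x `^ s * x `^ t.
Proof. by move=> x0; apply: powRD; rewrite (gt_eqF x0) implybT. Qed.

Lemma powR_exprn (R : realType) (x s : R) (k : nat) : 0 <= x -> (x ^+ k) `^ s = (x `^ s) ^+ k.
Proof.
move=> x0; rewrite -powR_mulrn// -powRrM mulrC powRrM powR_mulrn//.
exact: powR_ge0.
Qed.

Lemma geometric_sum_le (R : realType) (q : R) n : 0 <= q < 1 -> \sum_(k < n) q ^+ k <= (1 - q)^-1.
Proof.
move=> /andP[q0 q1]; rewrite -[leRHS]mul1r ler_pdivlMr ?subr_gt0//.
have := subrX1 q n; rewrite mulrC => e.
have -> : (\sum_(k < n) q ^+ k) * (1 - q) = 1 - q ^+ n.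
  by rewrite -opprB mulrN -e opprB.
by rewrite gerBl exprn_ge0.
Qed.

Lemma powRN_le (R : realType) (x y s : R) : 0 < s -> 0 < x -> x <= y -> y `^ (- s) <= x `^ (- s).
Proof.
move=> s0 x0 xy; have y0 := lt_le_trans x0 xy.
rewrite !powRN lef_pV2 ?posrE ?powR_gt0//.
by apply: ge0_ler_powR; rewrite ?nnegrE ?(ltW s0) ?(ltW x0) ?(ltW y0).
Qed.

Lemma powRN2 (R : realType) (e : R) : 0 < e -> e `^ (-2) = (e ^+ 2)^-1.
Proof. by move=> e0; rewrite powRN powR_mulrn ?ltW. Qed.

Section geometric_widths.
Context (R : realType) (h : nat -> R) (r rho K : R).
Context (h_gt0 : forall l, (1 <= l)%N -> 0 < h l).
Context (r_gt0 : 0 < r) (rho01 : 0 < rho < 1).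
Context (h_lower : forall l, (1 <= l)%N -> r * h l <= h l.+1).
Context (h_upper : forall l k, (1 <= l)%N -> h (l + k)%N <= K * rho ^+ k * h l).

Lemma width_const_ge1 : 1 <= K.
Proof.
have := h_upper 0 (leqnn 1); rewrite addn0 expr0 mulr1 ler_pMl//.
exact: h_gt0.
Qed.

Let K_gt0 : 0 < K.
Proof. exact: lt_le_trans ltr01 width_const_ge1. Qed.

Let rho_s (s : R) : 0 < s -> 0 <= rho `^ s < 1.
Proof.
move=> s0; have /andP[p0 p1] := rho01; rewrite powR_ge0/=.
have := @gt0_ltr_powR R s s0 rho 1.
by rewrite powR1; apply; rewrite ?nnegrE ?ltW.
Qed.

(** A positive power decays geometrically from the coarsest level on. *)
Lemma sum_widths_up (s : R) : 0 < s -> exists2 c : R, 0 < c &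
  forall l n, (1 <= l)%N -> \sum_(k < n) h (l + k)%N `^ s <= c * h l `^ s.
Proof.
move=> s0; have /andP[q0 q1] := rho_s s0.
have /andP[p0 _] := rho01.
exists (K `^ s * (1 - rho `^ s)^-1).
  by rewrite mulr_gt0 ?powR_gt0// invr_gt0 subr_gt0.
move=> l n l1; have hl := h_gt0 l1.
apply: (@le_trans _ _ (\sum_(k < n) K `^ s * h l `^ s * (rho `^ s) ^+ k)).
  apply: ler_sum => k _.
  rewrite -powR_exprn ?(ltW p0)// mulrAC -!powRM ?(ltW K_gt0) ?mulr_ge0 ?exprn_ge0
    ?(ltW hl) ?(ltW p0) ?(ltW K_gt0)//.
  apply: ge0_ler_powR; rewrite ?nnegrE ?(ltW s0)//.
  - by rewrite ltW// h_gt0// ltn_addr.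
  - by rewrite !mulr_ge0 ?exprn_ge0 ?(ltW K_gt0) ?(ltW p0) ?(ltW hl).
  - exact: h_upper.
rewrite -mulr_sumr mulrAC -mulrA [leRHS]mulrAC -[leRHS]mulrA.
rewrite [in leRHS]mulrA mulrA.
by rewrite mulrAC ler_wpM2l ?mulr_ge0 ?powR_ge0// geometric_sum_le// q0.
Qed.

(** A negative power decays geometrically from the finest level backwards. *)
Lemma sum_widths_down (s : R) : 0 < s -> exists2 c : R, 0 < c &
  forall L, (1 <= L)%N ->
    \sum_(1 <= l < L.+1) h l `^ (- s) <= c * h L `^ (- s).
Proof.
move=> s0; have /andP[q0 q1] := rho_s s0.
have /andP[p0 _] := rho01.
exists (K `^ s * (1 - rho `^ s)^-1).
  by rewrite mulr_gt0 ?powR_gt0// invr_gt0 subr_gt0.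
move=> L L1.
apply: (@le_trans _ _ (\sum_(1 <= l < L.+1)
    K `^ s * h L `^ (- s) * (rho `^ s) ^+ (L - l))).
  rewrite big_nat_cond [leRHS]big_nat_cond; apply: ler_sum => l.
  rewrite andbT => /andP[l1 lL].
  have := h_upper (L - l) l1; rewrite subnKC// => hL.
  have hl0 := h_gt0 l1; have hL0 := h_gt0 L1.
  have : h L `^ s <= K `^ s * (rho `^ s) ^+ (L - l) * h l `^ s.
    rewrite -powR_exprn ?(ltW p0)// -!powRM ?mulr_ge0 ?exprn_ge0 ?(ltW hl0) ?(ltW p0)
      ?(ltW K_gt0)//.
    apply: ge0_ler_powR; rewrite ?nnegrE ?(ltW s0) ?(ltW hL0)//.
    by rewrite !mulr_ge0 ?exprn_ge0 ?(ltW K_gt0) ?(ltW p0) ?(ltW hl0).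
  rewrite !powRN => h1.
  by rewrite [leRHS]mulrAC ler_pdivlMr ?powR_gt0// ler_pdivrMl ?powR_gt0// mulrC.
rewrite -mulr_sumr mulrAC ler_wpM2r ?powR_ge0//= ler_wpM2l ?powR_ge0//.
rewrite big_nat_rev /= big_add1 /= big_mkord.
rewrite (eq_bigr (fun k : 'I_L => (rho `^ s) ^+ k)).
  by apply: geometric_sum_le; rewrite q0.
move=> k _; congr (_ ^+ _).
move: (ltn_ord k); move: (nat_of_ord k) => i; clear; lia.
Qed.

Context (h_null : h n @[n --> \oo] --> 0).

(** The least level of width at most [delta]: the previous width exceeds
    [delta], and one refinement divides it by a bounded factor. *)
Lemma find_level (delta : R) : 0 < delta < h 1%N ->
  exists L, [/\ (1 <= L)%N, h L <= delta & r * delta <= h L].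
Proof.
move=> /andP[d0 d1].
have [N _ NP] : \forall n \near \oo, h n < delta by exact: (cvgr_lt _ h_null).
have ex : exists l, (1 <= l)%N && (h l <= delta).
  by exists N.+1; rewrite /= ltW//; apply: NP => /=; exact: leqnSn.
case: (ex_minnP ex) => L /andP[L1 Ld] Lmin; exists L; split=> //.
case: L L1 Ld Lmin => [//|[|L]] _ Ld Lmin; first by rewrite leNgt d1 in Ld.
apply: le_trans (h_lower (ltn0Sn L)); rewrite ler_wpM2l ?(ltW r_gt0)//.
rewrite leNgt; apply/negP => /ltW hd.
by have := Lmin L.+1; rewrite hd ltnn => /(_ isT).
Qed.

Context (C : nat -> R) (C0 : C 0%N = 0) (gamma Cgamma : R).
Context (gamma_gt0 : 0 < gamma) (Cgamma_gt0 : 0 < Cgamma).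
Context (C_rate : forall l, (1 <= l)%N -> C l <= Cgamma * h l `^ (- gamma)).

Lemma pair_cost_le l : (1 <= l)%N ->
  C l + C l.-1 <= Cgamma * (1 + K `^ gamma) * h l `^ (- gamma).
Proof.
move=> l1; rewrite mulrDr mulr1 mulrDl lerD//; first exact: C_rate.
case: l l1 => [//|[|l]] _ /=.
  by rewrite C0 !mulr_ge0 ?powR_ge0 ?(ltW Cgamma_gt0).
rewrite (le_trans (C_rate (ltn0Sn l)))// -mulrA ler_wpM2l ?(ltW Cgamma_gt0)//.
have hl0 := h_gt0 (ltn0Sn l); have hl1 := h_gt0 (ltn0Sn l.+1).
have hle : h l.+2 <= K * h l.+1.
  have := h_upper 1 (ltn0Sn l); rewrite addn1 expr1 => /le_trans; apply.
  rewrite ler_wpM2r ?(ltW hl0)// -[leRHS]mulr1 ler_wpM2l ?(ltW K_gt0)//.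
  by case/andP: rho01 => _ /ltW.
rewrite !powRN ler_pdivlMr ?powR_gt0// ler_pdivrMl ?powR_gt0// mulrC.
rewrite -powRM ?(ltW K_gt0) ?(ltW hl0)//.
by apply: ge0_ler_powR; rewrite ?nnegrE ?(ltW gamma_gt0) ?mulr_ge0 ?(ltW K_gt0)
  ?(ltW hl0) ?(ltW hl1).
Qed.

(** The sample sizes solve the Lagrange problem of minimal cost for a given
    variance, whence the exponent [(beta + gamma) / 2]; rounding them up costs at
    most one sample on each level, which is the last sum. *)
Lemma sample_sizes (beta v e : R) (L : nat) : 0 < v -> 0 < e -> (1 <= L)%N ->
  let S := \sum_(1 <= l < L.+1) h l `^ ((beta - gamma) / 2) in
  exists M : nat -> nat,
    [/\ forall l, (0 < M l)%N,
        v * \sum_(1 <= l < L.+1) h l `^ beta / (M l)%:R <= e ^+ 2 / 2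
      & ml_cost C L M <= Cgamma * (1 + K `^ gamma) *
          (2 * v / e ^+ 2 * S ^+ 2 + \sum_(1 <= l < L.+1) h l `^ (- gamma))].
Proof.
move=> v0 e0 L1 S.
have S0 : 0 < S.
  rewrite /S big_ltn ?ltnS// ltr_pwDl ?powR_gt0 ?h_gt0// sumr_ge0// => l _.
  exact: powR_ge0.
have e20 : 0 < e ^+ 2 by rewrite exprn_gt0.
pose k := 2 * v / e ^+ 2.
have k0 : 0 < k by rewrite divr_gt0// mulr_gt0.
pose x l := k * h l `^ ((beta + gamma) / 2) * S.
have x0 l : (1 <= l)%N -> 0 < x l.
  by move=> l1; rewrite mulr_gt0// mulr_gt0// powR_gt0// h_gt0.
have x_ge0 l : 0 <= x l.
  by rewrite mulr_ge0 ?(ltW S0)// mulr_ge0 ?powR_ge0 ?(ltW k0).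
pose M l := (Num.truncn (x l)).+1.
have M1 l : x l < (M l)%:R by case/andP: (truncn_itv (x_ge0 l)).
have M2 l : (M l)%:R <= x l + 1.
  by rewrite /M -natr1 lerD2r; case/andP: (truncn_itv (x_ge0 l)).
exists M; split=> //.
- rewrite mulr_sumr.
  apply: (@le_trans _ _ (\sum_(1 <= l < L.+1)
      e ^+ 2 / 2 / S * h l `^ ((beta - gamma) / 2))).
    rewrite big_nat_cond [leRHS]big_nat_cond; apply: ler_sum => l.
    rewrite andbT => /andP[l1 _]; have hl := h_gt0 l1.
    have xl := x0 l l1.
    apply: (@le_trans _ _ (v * (h l `^ beta / x l))).
      rewrite ler_wpM2l ?(ltW v0)// ler_wpM2l ?powR_ge0// lef_pV2 ?posrE ?ltr0n//.
      exact: ltW.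
    have -> : h l `^ beta = h l `^ ((beta + gamma) / 2) * h l `^ ((beta - gamma) / 2).
      by rewrite -powR_add//; congr (_ `^ _); field.
    rewrite /x /k le_eqVlt; apply/orP; left; apply/eqP; field.
    by rewrite !gt_eqF// powR_gt0.
  by rewrite -mulr_sumr divfK// gt_eqF.
rewrite /ml_cost mulrDr !mulr_sumr -/k.
have -> : k * S ^+ 2 = \sum_(1 <= l < L.+1) x l * h l `^ (- gamma).
  rewrite expr2 mulrA.
  transitivity (k * S * \sum_(1 <= l < L.+1) h l `^ ((beta - gamma) / 2)) => //.
  rewrite mulr_sumr.
  rewrite big_nat_cond [RHS]big_nat_cond.
  apply: eq_bigr => l; rewrite andbT => /andP[l1 _]; rewrite /x.
  rewrite -[RHS]mulrA [S * _]mulrC mulrA -[X in _ = X * _]mulrA -powR_add ?h_gt0//.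
  by rewrite mulrAC; congr (_ * _ `^ _ * _); field.
rewrite mulr_sumr -big_split /= big_nat_cond [leRHS]big_nat_cond.
apply: ler_sum => l; rewrite andbT => /andP[l1 _].
apply: (@le_trans _ _ ((M l)%:R * (Cgamma * (1 + K `^ gamma) * h l `^ (- gamma)))).
  by rewrite ler_wpM2l ?ler0n// pair_cost_le.
have cg : 0 <= Cgamma * (1 + K `^ gamma) * h l `^ (- gamma).
  by rewrite !mulr_ge0 ?addr_ge0 ?powR_ge0// ltW.
apply: le_trans (ler_wpM2r cg (M2 l)) _.
rewrite le_eqVlt; apply/orP; left; apply/eqP; ring.
Qed.

End geometric_widths.

(** * Cost of the multilevel method *)

Section complexity.
Context (R : realType) (h : nat -> R) (r rho K : R).
Context (h_gt0 : forall l, (1 <= l)%N -> 0 < h l).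
Context (r_gt0 : 0 < r) (rho01 : 0 < rho < 1).
Context (h_lower : forall l, (1 <= l)%N -> r * h l <= h l.+1).
Context (h_upper : forall l k, (1 <= l)%N -> h (l + k)%N <= K * rho ^+ k * h l).

Lemma widthN_le (s c a e hL : R) : 0 < s -> 0 < c -> 0 < a -> 0 < e ->
  c * e `^ a^-1 <= hL -> hL `^ (- s) <= c `^ (- s) * e `^ (- (s / a)).
Proof.
move=> s0 c0 a0 e0 ceh; have ea0 : 0 < e `^ a^-1 by exact: powR_gt0.
have -> : c `^ (- s) * e `^ (- (s / a)) = (c * e `^ a^-1) `^ (- s).
  rewrite powRM ?(ltW c0) ?(ltW ea0)// -powRrM; congr (_ * _ `^ _).
  by rewrite mulrN mulrC.
by apply: powRN_le => //; rewrite mulr_gt0.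
Qed.

(** Widths decay geometrically, so the number of levels is logarithmic in the
    tolerance. As [`|ln e|] is at least 1 it absorbs additive constants. *)
Lemma level_le_log (c a : R) : 0 < c -> 0 < a -> exists2 k : R, 0 < k &
  forall (e : R) L, 0 < e <= expR (-1) -> (1 <= L)%N -> c * e `^ a^-1 <= h L ->
    L%:R <= k * `|ln e|.
Proof.
move=> c0 a0; have /andP[p0 p1] := rho01.
have K1 := width_const_ge1 h_gt0 h_upper; have K0 := lt_le_trans ltr01 K1.
have h1 := h_gt0 (leqnn 1).
have lp : 0 < - ln rho by rewrite oppr_gt0 ln_lt0// p0.
pose B := ln (K * h 1%N) - ln c.
exists (1 + (`|B| + a^-1) / - ln rho).
  by rewrite ltr_wpDr// divr_ge0 ?(ltW lp)// addr_ge0// invr_ge0 ltW.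
move=> e [//|L] /andP[e0 e1] _ ceh.
have le1 : ln e <= -1 by rewrite -[leRHS](@expRK R) ler_ln ?posrE ?expR_gt0.
have nle : `|ln e| = - ln e by rewrite ler0_norm//; lra.
have : ln (c * e `^ a^-1) <= ln (K * h 1%N * rho ^+ L).
  rewrite ler_ln ?posrE ?mulr_gt0 ?powR_gt0 ?exprn_gt0//.
  rewrite (le_trans ceh)// mulrAC; have := h_upper L (leqnn 1).
  by rewrite add1n.
rewrite lnM ?posrE ?powR_gt0// lnM ?posrE ?mulr_gt0 ?exprn_gt0// ln_powR lnXn//.
move=> hL; have {hL}hB : L%:R * - ln rho <= B + a^-1 * `|ln e|.
  rewrite /B nle -mulr_natl in hL *; move: hL.
  by move: (ln (K * h 1%N)) (ln c) (L%:R * ln rho) => x y z; lra.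
have nl1 : 1 <= `|ln e| by rewrite nle; lra.
have : L%:R * - ln rho <= (`|B| + a^-1) * `|ln e|.
  rewrite (le_trans hB)// mulrDl lerD2r (le_trans (ler_norm B))//.
  by rewrite ler_peMr.
rewrite -ler_pdivlMr// => {}hB.
rewrite -natr1 mulrDl mul1r addrC lerD// (le_trans hB)//.
by rewrite mulrAC.
Qed.

Lemma sum_powR_ge0 (s : R) (n m : nat) : 0 <= \sum_(n <= l < m) h l `^ s.
Proof. by apply: sumr_ge0 => l _; exact: powR_ge0. Qed.

(** The three regimes: the sum is dominated by the coarsest level, by the finest
    level, or all levels contribute equally and it counts them. *)
Lemma weight_sum_rate (beta gamma a c : R) : 0 < a -> 0 < c ->
  exists2 k : R, 0 < k & forall (e : R) L,
    0 < e <= expR (-1) -> (1 <= L)%N -> c * e `^ a^-1 <= h L ->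
    (\sum_(1 <= l < L.+1) h l `^ ((beta - gamma) / 2)) ^+ 2 * e `^ (-2)
      <= k * cost_rate a beta gamma e.
Proof.
move=> a0 c0; have [gb|bg|bg] := ltgtP gamma beta.
- have s0 : 0 < (beta - gamma) / 2 by rewrite divr_gt0// subr_gt0.
  have [k k0 kP] := sum_widths_up h_gt0 rho01 h_upper s0.
  exists ((k * h 1%N `^ ((beta - gamma) / 2)) ^+ 2).
    by rewrite exprn_gt0// mulr_gt0// powR_gt0// h_gt0.
  move=> e L _ _ _; rewrite /cost_rate gb ler_wpM2r ?powR_ge0//.
  rewrite ler_sqr ?nnegrE ?sum_powR_ge0 ?mulr_ge0 ?powR_ge0 ?(ltW k0)//.
  by rewrite big_add1 big_mkord; exact: (kP 1%N L (leqnn 1)).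
- have s0 : 0 < (gamma - beta) / 2 by rewrite divr_gt0// subr_gt0.
  have [k k0 kP] := sum_widths_down h_gt0 rho01 h_upper s0.
  pose k' := k * c `^ (- ((gamma - beta) / 2)).
  have k'0 : 0 < k' by rewrite mulr_gt0// powR_gt0.
  exists (k' ^+ 2); first by rewrite exprn_gt0.
  move=> e L /andP[e0 _] L1 ceh; rewrite /cost_rate ltNge (ltW bg) /= lt_eqF//.
  have -> : (beta - gamma) / 2 = - ((gamma - beta) / 2) by field.
  have -> : -2 - (gamma - beta) / a =
      - ((gamma - beta) / 2 / a) + - ((gamma - beta) / 2 / a) + -2.
    by field; rewrite gt_eqF.
  rewrite !powR_add// mulrA ler_wpM2r ?powR_ge0// -expr2 -exprMn.
  rewrite ler_sqr ?nnegrE ?sum_powR_ge0 ?powR_ge0 ?mulr_ge0 ?powR_ge0 ?(ltW k0)//.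
  rewrite (le_trans (kP L L1))// /k' -[leRHS]mulrA ler_wpM2l ?(ltW k0)//.
  exact: widthN_le.
- have [k k0 kP] := level_le_log c0 a0.
  exists (k ^+ 2); first by rewrite exprn_gt0.
  move=> e L e01 L1 ceh; rewrite /cost_rate bg ltxx eqxx subrr mul0r.
  under eq_bigr do rewrite powRr0.
  rewrite sumr_const_nat subn1 /= mulrC [leRHS]mulrCA ler_wpM2l ?powR_ge0//.
  by rewrite -exprMn ler_sqr ?nnegrE ?ler0n ?mulr_ge0 ?(ltW k0)// kP.
Qed.

(** The left-hand side is the cost of one sample on each level; it stays within
    the rate when the bias decays at least like the square root of the variance,
    that is when [beta <= 2 * a]. *)
Lemma bias_cost_rate (beta gamma a e : R) : 0 < a -> beta <= 2 * a -> 0 < e <= expR (-1) ->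
  e `^ (- (gamma / a)) <= cost_rate a beta gamma e.
Proof.
move=> a0 b2a /andP[e0 e1].
have e01 : 0 < e <= 1.
  by rewrite e0 (le_trans e1)// -expR0 ler_expR lerN10.
rewrite /cost_rate; have [gb|bg|bg] := ltgtP gamma beta.
- apply: ger_powR => //; rewrite lerN2 ler_pdivrMr//.
  exact: le_trans (ltW gb) b2a.
- apply: ger_powR => //.
  have : beta / a <= 2 by rewrite ler_pdivrMr.
  by rewrite mulrBl; move: (beta / a) (gamma / a) => x y; lra.
- rewrite -[leLHS]mulr1; apply: ler_pM; rewrite ?powR_ge0//.
    apply: ger_powR => //; rewrite lerN2 ler_pdivrMr//.
    by rewrite bg.
  have : ln e <= -1 by rewrite -[leRHS](@expRK R) ler_ln ?posrE ?expR_gt0.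
  move=> le1; rewrite exprn_ege1// ler0_norm; lra.
Qed.

Context (h_null : h n @[n --> \oo] --> 0).

(** Take the first level whose squared bias is within half of [e ^+ 2], with
    optimally distributed samples. *)
Lemma mlmc_complexity (C : nat -> R) (Cgamma gamma beta a A v : R) :
  C 0%N = 0 -> 0 < gamma -> 0 < Cgamma ->
  (forall l, (1 <= l)%N -> C l <= Cgamma * h l `^ (- gamma)) ->
  0 < a -> beta <= 2 * a -> 0 < A -> 0 < v ->
  exists k e0 : R, [/\ 0 < k, 0 < e0 <= expR (-1) & forall e : R, 0 < e < e0 ->
    exists (L : nat) (M : nat -> nat),
      [/\ (1 <= L)%N, forall l, (0 < M l)%N,
          A * h L `^ (2 * a) + v * \sum_(1 <= l < L.+1) h l `^ beta / (M l)%:R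
            <= e ^+ 2
        & ml_cost C L M <= k * cost_rate a beta gamma e]].
Proof.
move=> C0 g0 Cg0 C_rate a0 b2a A0 v0.
have h1 := h_gt0 (leqnn 1).
pose c := (2 * A) `^ (- (2 * a)^-1).
have c0 : 0 < c by rewrite powR_gt0// mulr_gt0.
have rc0 : 0 < r * c by rewrite mulr_gt0.
have [k1 k10 k1P] := weight_sum_rate beta gamma a0 rc0.
have [k2 k20 k2P] := sum_widths_down h_gt0 rho01 h_upper g0.
pose c' := Cgamma * (1 + K `^ gamma).
have c'0 : 0 < c' by rewrite mulr_gt0// ltr_wpDr// powR_ge0.
pose k3 := k2 * (r * c) `^ (- gamma).
have k30 : 0 < k3 by rewrite mulr_gt0// powR_gt0.
pose e1 := (h 1%N / c) `^ a.
have hc0 : 0 < h 1%N / c by rewrite divr_gt0.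
exists (c' * (2 * v * k1 + k3)), (Num.min (expR (-1)) e1); split.
- by rewrite mulr_gt0// addr_gt0// mulr_gt0// mulr_gt0.
- by rewrite lt_min expR_gt0 powR_gt0//= ge_min lexx.
move=> e /andP[e0]; rewrite lt_min => /andP[ee ee1].
have e01 : 0 < e <= expR (-1) by rewrite e0 ltW.
have [|L [L1 Ld dL]] := find_level r_gt0 h_lower h_null (delta := c * e `^ a^-1).
  rewrite (mulr_gt0 c0 (powR_gt0 _ e0)) /= mulrC -ltr_pdivlMr//.
  have -> : h 1%N / c = e1 `^ a^-1.
    by rewrite /e1 -powRrM divff ?gt_eqF// powRr1// ltW.
  by apply: gt0_ltr_powR => //; rewrite ?invr_gt0 ?nnegrE ?(ltW e0) ?powR_ge0.
rewrite mulrA in dL.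
have [M [M0 Mvar Mcost]] :=
  sample_sizes h_gt0 rho01 h_upper C0 g0 Cg0 C_rate beta v0 e0 L1.
exists L, M; split=> //.
  rewrite [leRHS]splitr lerD//.
  apply: (@le_trans _ _ (A * (c * e `^ a^-1) `^ (2 * a))).
    rewrite ler_wpM2l ?(ltW A0)//; have hL := h_gt0 L1.
    apply: ge0_ler_powR => //; rewrite ?nnegrE ?mulr_ge0 ?powR_ge0 ?(ltW a0) ?(ltW hL)
      ?(ltW c0)//.
  rewrite powRM ?powR_ge0// /c -!powRrM mulNr mulVf ?gt_eqF ?mulr_gt0//.
  rewrite powR_inv1 ?mulr_ge0 ?(ltW A0)//.
  have -> : a^-1 * (2 * a) = 2 by field; rewrite gt_eqF.
  rewrite powR_mulrn ?(ltW e0)// le_eqVlt; apply/orP; left; apply/eqP; field.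
  by rewrite gt_eqF.
apply: le_trans Mcost _; rewrite -/c' -[leRHS]mulrA ler_wpM2l ?(ltW c'0)//.
rewrite [leRHS]mulrDl lerD//.
  rewrite -[leRHS]mulrA -[_ / _ * _]mulrA ler_wpM2l ?mulr_ge0 ?(ltW v0)//.
  by rewrite mulrC -powRN2// k1P.
rewrite (le_trans (k2P L L1))// /k3 -mulrA ler_wpM2l ?(ltW k20)//.
rewrite (le_trans (widthN_le g0 rc0 a0 e0 dL))// ler_wpM2l ?powR_ge0//.
exact: bias_cost_rate.
Qed.

Lemma cost_rate_anti (alpha a beta gamma e : R) : 0 < alpha -> alpha <= a ->
  0 < e <= 1 -> cost_rate a beta gamma e <= cost_rate alpha beta gamma e.
Proof.
move=> al0 ala e01; rewrite /cost_rate; have [gb|bg|bg] := ltgtP gamma beta => //.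
apply: ger_powR => //; rewrite lerD2l lerN2.
rewrite ler_wpM2l ?subr_ge0 ?(ltW bg)// lef_pV2 ?posrE//.
exact: lt_le_trans ala.
Qed.

End complexity.

(** * Bias and mean square error of multilevel sums *)

Section bias.
Context (R : realType) (h : nat -> R) (rho K : R).
Context (h_gt0 : forall l, (1 <= l)%N -> 0 < h l) (rho01 : 0 < rho < 1).
Context (h_upper : forall l k, (1 <= l)%N -> h (l + k)%N <= K * rho ^+ k * h l).
Context (h_null : h n @[n --> \oo] --> 0).

Lemma width_powR_small (alpha eps : R) l : 0 < alpha -> 0 < eps ->
  exists n, h (l + n.+1)%N `^ alpha <= eps.
Proof.
move=> a0 e0.
have e1 : 0 < eps `^ alpha^-1 by exact: powR_gt0.
have [N _ NP] : \forall n \near \oo, h n < eps `^ alpha^-1.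
  exact: (cvgr_lt _ h_null).
exists N; have hN : h (l + N.+1)%N < eps `^ alpha^-1.
  by apply: NP => /=; rewrite addnS leqW// leq_addl.
have -> : eps = (eps `^ alpha^-1) `^ alpha.
  by rewrite -powRrM mulVf ?gt_eqF// powRr1// ltW.
by apply: ge0_ler_powR; rewrite ?nnegrE ?(ltW a0) ?(ltW hN) ?(ltW e1)// ltW// h_gt0// addnS.
Qed.

(** Increments of order [h l `^ s] are summable over the levels, so a
    convergent sequence of means inherits this rate for its error. *)
Lemma bias_from_increments (s : R) : 0 < s -> exists2 k : R, 0 < k &
  forall (W : normedModType R) (m : nat -> W) (minf : W) (c c' alpha : R),
    0 < c' -> 0 < alpha -> 0 <= c ->
    (forall l, (1 <= l)%N -> `|m l.+1 - m l| <= c * h l.+1 `^ s) ->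
    (forall l, (1 <= l)%N -> `|minf - m l| <= c' * h l `^ alpha) ->
    forall l, (1 <= l)%N -> `|minf - m l| <= k * c * h l `^ s.
Proof.
move=> s0; have [k k0 kP] := sum_widths_up h_gt0 rho01 h_upper s0.
exists k => // W m minf c c' alpha c'0 a0 c0 inc lim l l1.
have tel n : `|m (l + n)%N - m l| <= \sum_(i < n) c * h (l + i.+1)%N `^ s.
  elim: n => [|n IHn]; first by rewrite addn0 subrr normr0 big_ord0.
  rewrite big_ord_recr /= addnS.
  have -> : m (l + n).+1 - m l = (m (l + n)%N - m l) + (m (l + n).+1 - m (l + n)%N).
    by rewrite [RHS]addrC addrA subrK.
  apply: le_trans (ler_normD _ _) (lerD IHn _).
  by apply: inc; rewrite ltn_addr.
apply/ler_addgt0Pr => eps eps0.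
have [n nP] := @width_powR_small alpha (eps / c') l a0 (divr_gt0 eps0 c'0).
have -> : minf - m l = (m (l + n.+1)%N - m l) + (minf - m (l + n.+1)%N).
  by rewrite [RHS]addrC addrA subrK.
apply: le_trans (ler_normD _ _) (lerD _ _).
  apply: le_trans (tel _) _; rewrite -mulr_sumr mulrAC mulrC ler_wpM2r//.
  have := kP l n.+2 l1; rewrite big_ord_recl /=; apply: le_trans.
  by rewrite ler_wpDl ?powR_ge0.
apply: le_trans (lim _ _) _; first by rewrite ltn_addr.
by rewrite mulrC -ler_pdivlMr.
Qed.

End bias.

Section multilevel.
Context (R : realType) d (T : measurableType d) (Q : probability T R).
Context (D : set T) (mD : measurable D) (QD : Q D = 1%E).
Context (W : completeNormedModType R) (dot : W -> W -> R).
Context (dotP : inner_product dot).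
Context d' (Om : measurableType d') (P : probability Om R).
Context (xi : nat -> nat -> Om -> T).
Context (mxi : forall l m, measurable_fun setT (xi l m)).
Context (law : forall l m C, measurable C ->
  fine (P (xi l m @^-1` C)) = fine (Q (D `&` C))).
Context (indep : forall (i j : nat * nat) A B, i != j ->
  measurable A -> measurable B ->
  fine (P (xi i.1 i.2 @^-1` A `&` xi j.1 j.2 @^-1` B)) =
  fine (Q (D `&` A)) * fine (Q (D `&` B))).
Context (F : nat -> T -> W) (m : nat -> W).
Context (F0 : F 0%N = fun=> 0) (bF : forall l, bsm (F l)).
Context (Fm : forall l, weak_mean Q D dot (F l) (m l)).

Let ml (L : nat) (M : nat -> nat) (om : Om) : W :=
  \sum_(1 <= l < L.+1) (M l)%:R^-1 *:
    \sum_(i < M l) (F l (xi l i om) - F l.-1 (xi l i om)).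

Lemma bsm_multilevel L M : bsm (ml L M).
Proof.
apply: bsm_sum => l; apply: bsmZ; first exact: bsm_cst.
by apply: bsm_sum => i; apply: bsmB; exact: (bsm_precomp (mxi _ _)).
Qed.

(** Around the mean on the finest level the estimator is a sum of centered
    independent terms; the factors 2 separate it from the bias. *)
Lemma multilevel_error L M (w : W) : (forall l, (0 < M l)%N) ->
  \int[P]_om `|w - ml L M om| ^+ 2 <=
  2 * `|w - m L| ^+ 2 +
  2 * \sum_(1 <= l < L.+1)
        (M l)%:R^-1 * \int[Q]_(x in D) `|F l x - F l.-1 x| ^+ 2.
Proof.
move=> M0.
pose s := [seq (l, i) | l <- index_iota 1 L.+1, i <- index_iota 0 (M l)].
pose G (i : nat * nat) x := F i.1 x - F i.1.-1 x.
pose g (i : nat * nat) := m i.1 - m i.1.-1.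
pose wt (i : nat * nat) : R := (M i.1)%:R^-1.
have bG i : bsm (G i) by exact: bsmB.
have Gg i : weak_mean Q D dot (G i) (g i) by exact: weak_meanB.
have us : uniq s.
  apply: allpairs_uniq_dep; rewrite ?iota_uniq//.
    by move=> l _; exact: iota_uniq.
  by move=> [l i] [l' i'] _ _ /= [-> ->].
have sE (V : nmodType) (f : nat * nat -> V) :
    \sum_(i <- s) f i = \sum_(1 <= l < L.+1) \sum_(i < M l) f (l, nat_of_ord i).
  rewrite /s big_allpairs_dep; apply: eq_bigr => l _.
  by rewrite -[in RHS](big_mkord xpredT (fun i => f (l, i))).
have m0 : m 0%N = 0.
  apply: (weak_mean_uniq dotP (Fm 0)); rewrite F0.
  exact: weak_mean_cst.
have Mu l : (M l)%:R != 0 :> R by rewrite pnatr_eq0 -lt0n.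
have mlE om : \sum_(i <- s) wt i *: (G i (xi i.1 i.2 om) - g i) = ml L M om - m L.
  rewrite sE /ml.
  have -> : m L = \sum_(1 <= l < L.+1) (m l - m l.-1).
    by rewrite big_add1 /= telescope_sumr// m0 subr0.
  rewrite -sumrB; apply: eq_bigr => l _.
  rewrite /wt /G /g /= -scaler_sumr sumrB scalerBr; congr (_ - _).
  by rewrite sumr_const card_ord -[X in _ *: X]scaler_nat scalerA mulVf// scale1r.
have bs : bsm (fun om => ml L M om - m L).
  by apply: bsmB; [exact: bsm_multilevel|exact: bsm_cst].
have var := @mean_square_sum_le _ _ _ Q D mD QD W dot dotP _ _ P _
  (fun i => xi i.1 i.2) s wt G g us (fun i => mxi i.1 i.2) (fun i => law i.1 i.2)
  indep bG Gg.
apply: (@le_trans _ _ (2 * `|w - m L| ^+ 2 +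
    2 * \int[P]_om `|ml L M om - m L| ^+ 2)).
  have <- : \int[P]_om (2 * `|w - m L| ^+ 2 + 2 * `|ml L M om - m L| ^+ 2) =
      2 * `|w - m L| ^+ 2 + 2 * \int[P]_om `|ml L M om - m L| ^+ 2.
    rewrite bsm_RintegralD//; last 2 first.
    - exact: bsm_cst.
    - by apply: bsm_mulr; [exact: bsm_cst|exact: bsm_norm_sqr].
    rewrite Rintegral_cst// [X in fine X]probability_setT mulr1.
    by rewrite bsm_RintegralZl//; exact: bsm_norm_sqr.
  apply: bsm_le_Rintegral => //.
  - by apply/bsm_norm_sqr/bsmB; [exact: bsm_cst|exact: bsm_multilevel].
  - apply: bsm_addr; first exact: bsm_cst.
    by apply: bsm_mulr; [exact: bsm_cst|exact: bsm_norm_sqr].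
  move=> om _; have -> : w - ml L M om = (w - m L) - (ml L M om - m L).
    by rewrite opprB addrA subrK.
  exact: (normB_sqr_le dotP).
rewrite lerD2l ler_wpM2l//.
rewrite (@eq_Rintegral _ _ _ P setT (fun om =>
  `|\sum_(i <- s) wt i *: (G i (xi i.1 i.2 om) - g i)| ^+ 2)); last first.
  by move=> om _; rewrite mlE.
apply: le_trans var _; rewrite sE.
rewrite le_eqVlt; apply/orP; left; apply/eqP; apply: eq_bigr => l _.
rewrite /wt /G /= sumr_const card_ord -[LHS]mulr_natl mulrA; congr (_ * _).
by rewrite expr2 mulrA divff// mul1r.
Qed.

End multilevel.

(** * The sampling model *)

Section sampling_facts.
Context (R : realType) (mu : probability (rseq R) R).
Context (d : measure_display) (Om : measurableType d) (P : probability Om R).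
Context (xi : nat -> nat -> Om -> rseq R) (xi_iid : iid_samples P mu xi).

Lemma measurable_box : measurable (box R).
Proof.
rewrite (_ : box R = \bigcap_j [set z : rseq R | -1 <= z j <= 1]).
  apply: bigcapT_measurable => j.
  have mI : measurable (`[-1, 1]%classic : set (measurableTypeR R)).
    exact: measurable_itv.
  have := @measurable_coord R j measurableT _ mI; rewrite setTI.
  by congr (measurable _); apply/seteqP; split=> z /=; rewrite in_itv.
by apply/seteqP; split=> [z zb j _|z zb j]; [exact: zb|exact: (zb j)].
Qed.

Lemma sample_law l m C : measurable C ->
  fine (P (xi l m @^-1` C)) = fine (mu (box R `&` C)).
Proof.
case: xi_iid => xib _ law _ mC; rewrite -(law l m); last first.
  by apply: measurableI => //; exact: measurable_box.
congr (fine (P _)); apply/seteqP; split=> om /= => [?|[]//].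
by split=> //; exact: xib.
Qed.

Lemma prob_box : mu (box R) = 1%E.
Proof.
case: xi_iid => xib _ law _; rewrite -(law 0%N 0%N); last exact: measurable_box.
rewrite (_ : _ @^-1` _ = setT) ?probability_setT//.
by apply/seteqP; split=> om //= _; exact: xib.
Qed.

Lemma sample_pair_law (i j : nat * nat) A B : i != j ->
  measurable A -> measurable B ->
  fine (P (xi i.1 i.2 @^-1` A `&` xi j.1 j.2 @^-1` B)) =
  fine (mu (box R `&` A)) * fine (mu (box R `&` B)).
Proof.
move=> ij mA mB; case: (xi_iid) => _ _ _ indep.
have := indep [:: i; j] (fun k => if k == i then A else B) _ _.
rewrite !big_cons big_nil mulr1 eqxx eq_sym (negbTE ij) !sample_law// => <-.
- congr (fine (P _)); apply/seteqP; split=> om /=.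
    move=> [iA jB] k /=; rewrite !inE => /orP[]/eqP ->; first by rewrite eqxx.
    by rewrite eq_sym (negbTE ij).
  move=> h; split; first by have := h i; rewrite /= eqxx; apply; rewrite inE eqxx.
  have := h j; rewrite /= eq_sym (negbTE ij); apply.
  by rewrite !inE eqxx orbT.
- by rewrite /= inE ij.
- by move=> k; case: ifP.
Qed.

Let sOm := g_sigma_algebraType (sample_events xi).

Lemma measurable_sample l m : measurable_fun setT (xi l m : sOm -> rseq R).
Proof.
move=> _ C mC; rewrite setTI; apply: sub_sigma_algebra.
by exists l, m, C.
Qed.

Lemma measurable_id_samples : measurable_fun setT (id : Om -> sOm).
Proof.
move=> _ A mA; rewrite setTI preimage_id.
suff : <<s sample_events xi >> `<=` measurable by apply.
apply: smallest_sub; first exact: sigma_algebra_measurable.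
move=> _ [l [m [C [mC ->]]]]; case: xi_iid => _ mxi _ _.
by rewrite -[X in measurable X]setTI; exact: mxi.
Qed.

(** A function of samples that are independent of [Fk] has its plain
    expectation as conditional expectation. *)
Lemma condexp_samples (Fk : set (set Om)) (f : Om -> R) :
  sub_sigma_algebra_of_events Fk -> independent_of_samples P Fk xi ->
  bsm (f : sOm -> R^o) ->
  is_condexp P Fk f (fun=> \int[P]_om f om).
Proof.
move=> [sFk Fkm] indep bf.
have bf' : bsm (f : Om -> R^o) := bsm_precomp measurable_id_samples bf.
have bE : bsm ((fun=> \int[P]_om f om) : Om -> R^o) by exact: bsm_cst.
split.
- exact: (bsm_integrable P measurableT bf').
- exact: (bsm_integrable P measurableT bE).
- move=> A _; case: sFk => F0 FC _.
  have FT : Fk setT by rewrite -(setD0 setT); exact: FC.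
  have [EA|nEA] := pselect (A (\int[P]_om f om)).
    by rewrite (_ : _ @^-1` _ = setT)//; apply/seteqP; split.
  by rewrite (_ : _ @^-1` _ = set0)//; apply/seteqP; split.
move=> A FA; have mA := Fkm _ FA.
rewrite (bsm_integralE P mA bf') (bsm_integralE P mA bE); congr EFin.
rewrite Rintegral_cst// mulrC.
have pm (C : set sOm) : measurable C -> measurable (id @^-1` C : set Om).
  move=> mC; rewrite -[X in measurable X]setTI.
  exact: (measurable_id_samples measurableT mC).
symmetry; apply: (bsm_transfer mA measurableT measurable_id_samples
  measurable_id_samples (f := f) (k := fine (P A))) => // C mC.
rewrite setTI indep// fineM//; apply: fin_num_measure => //; exact: pm.
Qed.

End sampling_facts.

(** * Ratio estimators *)

Lemma inv_max1_lipschitz (R : realType) (x y : R) :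
  `|(Num.max 1 x)^-1 - (Num.max 1 y)^-1| <= `|x - y|.
Proof.
have max1 z : 1 <= Num.max 1 z :> R by rewrite le_max lexx.
have max0 z : 0 < Num.max 1 z :> R := lt_le_trans ltr01 (max1 z).
have -> : (Num.max 1 x)^-1 - (Num.max 1 y)^-1 =
    (Num.max 1 y - Num.max 1 x) * ((Num.max 1 x)^-1 * (Num.max 1 y)^-1).
  by field; rewrite !gt_eqF.
rewrite normrM -[leRHS]mulr1 ler_pM//.
  rewrite distrC; have [x1|x1] := leP 1 x; have [y1|y1] := leP 1 y => //.
  - by rewrite !ger0_norm ?subr_ge0 ?(ltW (lt_le_trans y1 x1)) ?lerB// ltW.
  - rewrite distrC [leRHS]distrC.
    by rewrite !ger0_norm ?subr_ge0 ?(ltW (lt_le_trans x1 y1)) ?lerB// ltW.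
  - by rewrite subrr normr0.
rewrite ger0_norm ?mulr_ge0 ?invr_ge0 ?(ltW (max0 _))//.
by rewrite mulr_ile1 ?invr_ge0 ?(ltW (max0 _))// invf_le1.
Qed.

Lemma bsm_inv_max1 (R : realType) d (T : measurableType d) (f : T -> R) :
  bsm (f : T -> R^o) -> bsm (fun x => (Num.max 1 (f x))^-1 : R^o).
Proof.
move=> bf.
apply: (@bsm_map2 _ _ _ R^o R^o R^o (fun x _ => (Num.max 1 x)^-1 : R) f f) => //.
  move=> B; exists 1 => x _ _ _.
  have max1 : 1 <= Num.max 1 x :> R by rewrite le_max lexx.
  have max0 := lt_le_trans ltr01 max1.
  by rewrite gtr0_norm ?invr_gt0// invf_le1.
move=> a _ x _ ax _; apply: (@cvg_dist _ R^o _ _ (fun n => `|(a n : R) - x|)).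
  by move=> n; exact: inv_max1_lipschitz.
rewrite -(@normr0 _ R^o) -(subrr x); apply: cvg_norm.
by apply: cvgB => //; exact: cvg_cst.
Qed.

(** Truncating the denominator at 1 keeps the quotient stable, and brings the
    denominator no further from [b], which is itself at least 1. *)
Lemma ratio_error (R : realType) (W : normedModType R) (a a' : W) (b b' : R) :
  1 <= b -> `|b^-1 *: a - (Num.max 1 b')^-1 *: a'| <=
    `|a - a'| + `|a| * `|b - b'|.
Proof.
move=> b1; have bE : b = Num.max 1 b by apply/esym/max_idPr.
set c := Num.max 1 b'.
have c1 : 1 <= c by rewrite le_max lexx.
have c0 := lt_le_trans ltr01 c1.
have -> : b^-1 *: a - c^-1 *: a' = c^-1 *: (a - a') + (b^-1 - c^-1) *: a.
  by rewrite scalerBr scalerBl [RHS]addrC addrA subrK.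
apply: le_trans (ler_normD _ _) (lerD _ _); rewrite normrZ.
  rewrite gtr0_norm ?invr_gt0// -[leRHS]mul1r ler_wpM2r//.
  by rewrite invf_le1.
by rewrite mulrC ler_wpM2l// {1}bE; exact: inv_max1_lipschitz.
Qed.

(** * Strong measurability of the observables *)

Section level_rates.
Context (R : realType) (V H U : hilbert R) (pb : problem V H U).
Context (dc : discretization pb) (mu : probability (rseq R) R).
Context (theta : R) (theta_gt0 : 0 < theta).

Let Yc u l z := Ylevel dc theta u l (clamp z).
Let Xc u l z := Xlevel dc theta u l (clamp z).

Lemma bsm_Ylevel u l : Uad pb u -> bsm (Yc u l : rseq R -> R^o).
Proof.
move=> uU; case: l => [|l]; first exact: bsm_cst.
by have [] := galerkin_bsm theta_gt0 uU (galerkin_pair_fe dc u (ltn0Sn l)).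
Qed.

Lemma bsm_Xlevel u l : Uad pb u -> bsm (Xc u l).
Proof.
move=> uU; case: l => [|l]; first exact: bsm_cst.
have [bY _ bq] := galerkin_bsm theta_gt0 uU (galerkin_pair_fe dc u (ltn0Sn l)).
exact: bsmZ bY bq.
Qed.

Lemma bsm_Yexact u : Uad pb u ->
  bsm (fun z => Yexact pb theta u (clamp z) : R^o).
Proof.
by move=> uU; have [] := galerkin_bsm theta_gt0 uU (galerkin_pair_exact pb u).
Qed.

Lemma bsm_Xexact u : Uad pb u -> bsm (fun z => Xexact pb theta u (clamp z)).
Proof.
move=> uU.
have [bY _ bq] := galerkin_bsm theta_gt0 uU (galerkin_pair_exact pb u).
exact: bsmZ bY bq.
Qed.

Lemma mean_weak_mean (f : rseq R -> R) : bsm (fun z => f (clamp z) : R^o) ->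
  weak_mean mu (box R) (fun x y : R^o => x * y : R) (fun z => f (clamp z))
    (mean mu f).
Proof.
move=> bf v; have mb := @measurable_box R.
rewrite RintegralZr//; last exact: bsm_integrable.
congr (_ * _); apply: eq_Rintegral => z /set_mem zb.
by rewrite clamp_id.
Qed.

Lemma vmean_weak_mean (f : rseq R -> U) : bsm (fun z => f (clamp z)) ->
  weak_mean mu (box R) (hdot U) (fun z => f (clamp z)) (vmean mu f).
Proof.
move=> bf; rewrite /vmean.
apply: (@bochner_weak_mean _ _ _ mu _ (@measurable_box R) U _
  (hdot_inner_product U) (fun z => f (clamp z)) f bf).
by move=> z zb; rewrite clamp_id.
Qed.

End level_rates.

(** * Increments between levels *)

Section level_increments.
Context (R : realType) (V H U : hilbert R) (pb : problem V H U).
Context (dc : discretization pb) (mu : probability (rseq R) R).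
Context (mu_box : mu (box R) = 1%E).
Context (theta : R) (theta_gt0 : 0 < theta).
Context (h : nat -> R) (h_gt0 : forall l, (1 <= l)%N -> 0 < h l).
Context (beta Cy Cq : R) (Cy_gt0 : 0 < Cy) (Cq_gt0 : 0 < Cq).
Context (y_rate : forall u l, Uad pb u -> (1 <= l)%N ->
  (\int[mu]_(z in box R)
     (`|emb pb (fe_state dc l z u) - emb pb (fe_state dc l.-1 z u)| ^+ 2)%:E
   <= (Cy * h l `^ beta)%:E)%E).
Context (q_rate : forall u l, Uad pb u -> (1 <= l)%N ->
  (\int[mu]_(z in box R)
     (`|ctrl_adj pb (fe_adjoint dc l z u)
        - ctrl_adj pb (fe_adjoint dc l.-1 z u)| ^+ 2)%:E
   <= (Cq * h l `^ beta)%:E)%E).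

Let Yc u l z := Ylevel dc theta u l (clamp z).
Let Xc u l z := Xlevel dc theta u l (clamp z).
Let mbox := @measurable_box R.

Lemma box_Rintegral_le (f : rseq R -> R) (c : R) :
  bsm (fun z => f (clamp z) : R^o) ->
  (\int[mu]_(z in box R) (f z)%:E <= c%:E)%E ->
  \int[mu]_(z in box R) f (clamp z) <= c.
Proof.
move=> bf; rewrite -lee_fin -bsm_integralE//; apply: le_trans.
rewrite le_eqVlt; apply/orP; left; apply/eqP.
by apply: eq_integral => z /set_mem zb; rewrite clamp_id.
Qed.

(** On the first level the increment is the whole bounded observable, which a
    multiple of the fixed positive number [h 1 `^ beta] dominates; on the others
    the Lipschitz bounds transfer the rates of the states and adjoints. *)
Lemma increment_rates : exists2 v : R, 0 < v &
  forall u l, Uad pb u -> (1 <= l)%N ->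
    \int[mu]_(z in box R) `|Yc u l z - Yc u l.-1 z| ^+ 2 <= v * h l `^ beta /\
    \int[mu]_(z in box R) `|Xc u l z - Xc u l.-1 z| ^+ 2 <= v * h l `^ beta.
Proof.
have [KY [Kq [CL [KY1 Kq0 CL0 bd]]]] := galerkin_bounds pb theta_gt0.
have KY0 := lt_le_trans ltr01 KY1.
have h1 : 0 < h 1%N `^ beta by rewrite powR_gt0// h_gt0.
pose v1 := (KY ^+ 2 + (KY * Kq) ^+ 2) / h 1%N `^ beta.
pose v2 := CL ^+ 2 * Cy + (2 * KY ^+ 2 * Cq + 2 * (Kq * CL) ^+ 2 * Cy).
have v10 : 0 < v1 by rewrite divr_gt0// addr_gt0// exprn_gt0// mulr_gt0.
have v20 : 0 < v2.
  have p2 (x : R) : 0 < x -> 0 < x ^+ 2 by exact: exprn_gt0.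
  rewrite addr_gt0 ?mulr_gt0 ?p2//.
  by rewrite addr_gt0 ?mulr_gt0 ?p2 ?mulr_gt0// .
exists (v1 + v2); first by rewrite addr_gt0.
have cst_le (f : rseq R -> R) (k : R) : bsm (f : rseq R -> R^o) ->
    (forall z, box R z -> f z <= k) -> \int[mu]_(z in box R) f z <= k.
  move=> bf fk; have -> : k = \int[mu]_(z in box R) k.
    by rewrite Rintegral_cst// [X in fine X]mu_box mulr1.
  by apply: bsm_le_Rintegral => //; exact: bsm_cst.
move=> u l uU l1.
have bYd : bsm (fun z => Yc u l z - Yc u l.-1 z : R^o).
  by apply: (@bsmB _ _ _ R^o); exact: bsm_Ylevel.
have bXd : bsm (fun z => Xc u l z - Xc u l.-1 z).
  by apply: bsmB; exact: bsm_Xlevel.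
have wv (x : R) (k : R) : 0 <= k -> x <= k * h l `^ beta ->
    forall k' : R, k <= k' -> x <= k' * h l `^ beta.
  move=> k0 xk k' kk'; apply: le_trans xk _.
  by rewrite ler_wpM2r ?powR_ge0.
case: l l1 bYd bXd wv => [//|[|l]] l1 bYd bXd wv.
- have gp := galerkin_pair_fe dc u l1.
  split; apply: (wv _ v1); rewrite ?(ltW v10) ?lerDl ?(ltW v20)//.
  + rewrite divfK ?gt_eqF//; apply: cst_le; first exact: (@bsm_norm_sqr _ _ _ R^o).
    move=> z zb; have [/andP[w1 w2] _ _] := bd _ _ _ _ uU gp _ (clamp_box z).
    rewrite /Yc /= subr0 ger0_norm ?expR_ge0//.
    rewrite (@le_trans _ _ (KY ^+ 2)) ?lerDl ?sqr_ge0//.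
    by rewrite ler_sqr ?nnegrE ?expR_ge0 ?(ltW KY0).
  + rewrite divfK ?gt_eqF//; apply: cst_le; first exact: bsm_norm_sqr.
    move=> z zb; have [/andP[w1 w2] wq _] := bd _ _ _ _ uU gp _ (clamp_box z).
    rewrite /Xc /= subr0 (@le_trans _ _ ((KY * Kq) ^+ 2)) ?lerDr ?sqr_ge0//.
    rewrite ler_sqr ?nnegrE ?mulr_ge0 ?(ltW KY0) ?(ltW Kq0)//.
    by rewrite normrZ ger0_norm ?expR_ge0// ler_pM ?expR_ge0.
- have gp := galerkin_pair_fe dc u l1.
  have gp' := galerkin_pair_fe dc u (ltn0Sn l).
  have [bY be bq] := galerkin_bsm theta_gt0 uU gp.
  have [bY' be' bq'] := galerkin_bsm theta_gt0 uU gp'.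
  have bde : bsm (fun z => emb pb (fe_state dc l.+2 (clamp z) u) -
      emb pb (fe_state dc l.+1 (clamp z) u)) by exact: bsmB.
  have bdq : bsm (fun z => ctrl_adj pb (fe_adjoint dc l.+2 (clamp z) u) -
      ctrl_adj pb (fe_adjoint dc l.+1 (clamp z) u)) by exact: bsmB.
  have ye := box_Rintegral_le
    (f := fun z => `|emb pb (fe_state dc l.+2 z u) - emb pb (fe_state dc l.+1 z u)| ^+ 2)
    (bsm_norm_sqr bde) (y_rate uU l1).
  have qe := box_Rintegral_le
    (f := fun z => `|ctrl_adj pb (fe_adjoint dc l.+2 z u)
                     - ctrl_adj pb (fe_adjoint dc l.+1 z u)| ^+ 2)
    (bsm_norm_sqr bdq) (q_rate uU l1).
  rewrite /= in ye qe.
  have Yd z : `|Yc u l.+2 z - Yc u l.+1 z| <=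
      CL * `|emb pb (fe_state dc l.+2 (clamp z) u)
             - emb pb (fe_state dc l.+1 (clamp z) u)|.
    have [_ _ lip] := bd _ _ _ _ uU gp _ (clamp_box z).
    exact: lip gp'.
  have be2 := bsm_norm_sqr bde; have bq2 := bsm_norm_sqr bdq.
  split.
  + apply: (wv _ (CL ^+ 2 * Cy)).
    * by rewrite mulr_ge0 ?sqr_ge0 ?(ltW Cy_gt0).
    * rewrite -mulrA; apply: le_trans (ler_wpM2l (sqr_ge0 CL) ye).
      rewrite -bsm_RintegralZl//; apply: bsm_le_Rintegral => //.
      - exact: (@bsm_norm_sqr _ _ _ R^o).
      - by apply: bsm_mulr => //; exact: bsm_cst.
      move=> z _; rewrite -exprMn ler_sqr ?nnegrE ?mulr_ge0 ?(ltW CL0)//.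
    * rewrite (@le_trans _ _ v2) ?lerDr ?(ltW v10)// lerDl addr_ge0//.
        by rewrite mulr_ge0 ?(ltW Cq_gt0)// mulr_ge0 ?sqr_ge0.
      by rewrite mulr_ge0 ?(ltW Cy_gt0)// mulr_ge0 ?sqr_ge0.
  + apply: (wv _ (2 * KY ^+ 2 * Cq + 2 * (Kq * CL) ^+ 2 * Cy)).
    * apply: addr_ge0; apply: mulr_ge0; rewrite ?(ltW Cq_gt0) ?(ltW Cy_gt0)//;
        by apply: mulr_ge0; rewrite ?sqr_ge0.
    * have k1 : 0 <= 2 * KY ^+ 2 by rewrite mulr_ge0 ?sqr_ge0.
      have k2 : 0 <= 2 * (Kq * CL) ^+ 2 by rewrite mulr_ge0 ?sqr_ge0.
      rewrite mulrDl -(mulrA _ Cq) -(mulrA _ Cy).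
      apply: le_trans (lerD (ler_wpM2l k1 qe) (ler_wpM2l k2 ye)).
      rewrite -!bsm_RintegralZl// -bsm_RintegralD//; last 2 first.
      - by apply: bsm_mulr => //; exact: bsm_cst.
      - by apply: bsm_mulr => //; exact: bsm_cst.
      apply: bsm_le_Rintegral => //; first exact: bsm_norm_sqr.
        by apply: bsm_addr; apply: bsm_mulr => //; exact: bsm_cst.
      move=> z _.
      have [/andP[w1 w2] wq _] := bd _ _ _ _ uU gp _ (clamp_box z).
      have [_ wq' _] := bd _ _ _ _ uU gp' _ (clamp_box z).
      have := Yd z; rewrite /Yc /Xc /=.
      set a := expR _; set b := expR _; set p := ctrl_adj pb _; set p' := ctrl_adj pb _.
      set E := `|emb _ _ - _| => Yz.
      have e1 : `|a *: p - b *: p'| <= KY * `|p - p'| + Kq * CL * E.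
        have -> : a *: p - b *: p' = a *: (p - p') + (a - b) *: p'.
          by rewrite scalerBr scalerBl addrA subrK.
        apply: le_trans (ler_normD _ _) (lerD _ _); rewrite normrZ.
          by rewrite ger0_norm ?expR_ge0// ler_wpM2r.
        by rewrite mulrC -mulrA ler_pM.
      apply: (@le_trans _ _ ((KY * `|p - p'| + Kq * CL * E) ^+ 2)).
        rewrite ler_sqr ?nnegrE// addr_ge0 ?mulr_ge0 ?(ltW KY0) ?(ltW Kq0) ?(ltW CL0)//.
        exact: normr_ge0.
      rewrite -subr_ge0.
      apply: le_trans (sqr_ge0 (KY * `|p - p'| - Kq * CL * E)) _.
      rewrite le_eqVlt; apply/orP; left; apply/eqP; ring.
    * apply: (@le_trans _ _ v2); last by rewrite lerDr ltW.
      by rewrite lerDr mulr_ge0 ?sqr_ge0// ltW.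
Qed.

End level_increments.

(** * Complexity of the gradient estimator *)

(** By Jensen the means inherit the exponent [beta / 2] of the increments, hence
    so does the bias. The larger of both exponents is at least [beta / 2], as
    [mlmc_complexity] requires. *)
Lemma bias_rate (R : realType) (h : nat -> R) (rho K alpha beta v : R) :
  (forall l, (1 <= l)%N -> 0 < h l) -> 0 < rho < 1 ->
  (forall l k, (1 <= l)%N -> h (l + k)%N <= K * rho ^+ k * h l) ->
  h n @[n --> \oo] --> 0 -> 0 < alpha -> 0 < beta -> 0 < v ->
  exists2 k : R, 0 < k &
  forall (W : normedModType R) (m : nat -> W) (w : W) (c : R), 0 < c ->
    (forall l, (1 <= l)%N -> `|m l.+1 - m l| ^+ 2 <= v * h l.+1 `^ beta) ->
    (forall l, (1 <= l)%N -> `|w - m l| <= c * h l `^ alpha) ->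
    forall l, (1 <= l)%N ->
      `|w - m l| <= (c + k) * h l `^ (Num.max alpha (beta / 2)).
Proof.
move=> h0 rho01 hU hN a0 b0 v0.
have s0 : 0 < beta / 2 by rewrite divr_gt0.
have [k k0 kP] := bias_from_increments h0 rho01 hU hN s0.
exists (k * Num.sqrt v); first by rewrite mulr_gt0// sqrtr_gt0.
move=> W m w c c0 inc lim l l1.
have [ba|ab] := leP (beta / 2) alpha.
  rewrite (le_trans (lim l l1))// ler_wpM2r ?powR_ge0// lerDl.
  by rewrite mulr_ge0 ?sqrtr_ge0 ?ltW.
have := kP W m w (Num.sqrt v) c alpha c0 a0 (sqrtr_ge0 v) _ lim l l1.
move=> h1; apply: le_trans (h1 _) _; last first.
  by rewrite ler_wpM2r ?powR_ge0// lerDr ltW.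
move=> i i1; rewrite -ler_sqr ?nnegrE ?mulr_ge0 ?sqrtr_ge0 ?powR_ge0//.
rewrite exprMn sqr_sqrtr ?(ltW v0)// (le_trans (inc i i1))//.
rewrite expr2 -powR_add ?h0//.
by have -> : beta / 2 + beta / 2 = beta by field.
Qed.

Theorem theorem3p4 (R : realType) (V H U : hilbert R) (pb : problem V H U)
    (dc : discretization pb)
    (mu : probability (rseq R) R) (mu_unif : product_uniform mu)
    (d : measure_display) (Om : measurableType d) (P : probability Om R)
    (P_complete : measure_is_complete P)
    (xi : nat -> nat -> Om -> rseq R) (xi_iid : iid_samples P mu xi)
    (Fk : set (set Om)) (Fk_sub : sub_sigma_algebra_of_events Fk)
    (Fk_indep : independent_of_samples P Fk xi)
    (h : nat -> R) (h_gt0 : forall l, (1 <= l)%N -> 0 < h l)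
    (h_null : h @ \oo --> 0) (h_geom : geometric_refinement h)
    (beta Cy Cq : R) (beta_gt0 : 0 < beta) (Cy_gt0 : 0 < Cy) (Cq_gt0 : 0 < Cq)
    (y_rate : forall u l, Uad pb u -> (1 <= l)%N ->
       (\int[mu]_(z in box R)
          (`|emb pb (fe_state dc l z u) - emb pb (fe_state dc l.-1 z u)| ^+ 2)%:E
        <= (Cy * h l `^ beta)%:E)%E)
    (q_rate : forall u l, Uad pb u -> (1 <= l)%N ->
       (\int[mu]_(z in box R)
          (`|ctrl_adj pb (fe_adjoint dc l z u)
             - ctrl_adj pb (fe_adjoint dc l.-1 z u)| ^+ 2)%:E
        <= (Cq * h l `^ beta)%:E)%E)
    (alpha : R) (CY CX : R -> R) (alpha_gt0 : 0 < alpha)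
    (CY_gt0 : forall theta, 0 < theta -> 0 < CY theta)
    (CX_gt0 : forall theta, 0 < theta -> 0 < CX theta)
    (Y_bias : forall theta u l, 0 < theta -> Uad pb u -> (1 <= l)%N ->
       `|mean mu (fun z => Yexact pb theta u z - Ylevel dc theta u l z)|
       <= CY theta * h l `^ alpha)
    (X_bias : forall theta u l, 0 < theta -> Uad pb u -> (1 <= l)%N ->
       `|vmean mu (fun z => Xexact pb theta u z - Xlevel dc theta u l z)|
       <= CX theta * h l `^ alpha)
    (C : nat -> R) (C0 : C 0%N = 0) (C_ge0 : forall l, 0 <= C l)
    (Cgamma gamma : R) (Cgamma_gt0 : 0 < Cgamma) (gamma_gt0 : 0 < gamma)
    (C_rate : forall l, (1 <= l)%N -> C l <= Cgamma * h l `^ (- gamma))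
    (theta : R) (theta_gt0 : 0 < theta) :
  exists K e0 : R, [/\ 0 < K, 0 < e0 &
    forall (u : U) (e : R), Uad pb u -> 0 < e < e0 ->
    exists (L : nat) (M : nat -> nat),
      [/\ (1 <= L)%N,
          forall l, (1 <= l <= L)%N -> (0 < M l)%N,
          exists Z : Om -> R,
            is_condexp P Fk
              (fun om => `|gradJ pb mu theta u
                           - gradJ_ML dc theta xi L M u om| ^+ 2) Z
            /\ {ae P, forall om, Z om <= e ^+ 2}
        & ml_cost C L M <= K * cost_rate alpha beta gamma e]].
Proof.
have [r [rho [K [r0 rho01 h_lower h_upper]]]] := h_geom.
have mbox := @measurable_box R.
have mub := prob_box xi_iid.
have ipU := hdot_inner_product U.
have ipR := inner_product_mul R.
have [v v0 incr] := increment_rates mub theta_gt0 h_gt0 Cy_gt0 Cq_gt0 y_rate q_rate.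
have [k k0 biasP] := bias_rate h_gt0 rho01 h_upper h_null alpha_gt0 beta_gt0 v0.
have [KY [Kq [CL [KY1 Kq0 CL0 bd]]]] := galerkin_bounds pb theta_gt0.
(* The exponent of the bias that is at least [beta / 2]. *)
pose a := Num.max alpha (beta / 2).
have a0 : 0 < a by rewrite lt_max alpha_gt0.
have b2a : beta <= 2 * a by rewrite mulrC -ler_pdivrMr// le_max lexx orbT.
pose bX := CX theta + k; pose bY := CY theta + k.
have bX0 : 0 < bX by rewrite addr_gt0// CX_gt0.
have bY0 : 0 < bY by rewrite addr_gt0// CY_gt0.
pose B := KY * Kq.
have KY0 : 0 < KY := lt_le_trans ltr01 KY1.
have B0 : 0 < B by rewrite mulr_gt0.
(* Constants in front of the squared bias and of the variances that remain
   after two applications of [(x + y)^2 <= 2 x^2 + 2 y^2]: to the error of the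
   quotient, then to the errors of its numerator and denominator. *)
pose A := 4 * bX ^+ 2 + 4 * B ^+ 2 * bY ^+ 2.
pose vv := 4 * v + 4 * B ^+ 2 * v.
have A0 : 0 < A.
  by apply: addr_gt0; rewrite !mulr_gt0// exprn_gt0.
have vv0 : 0 < vv.
  by apply: addr_gt0; rewrite ?mulr_gt0// exprn_gt0.
have [Kc [e0 [Kc0 /andP[e00 e01] cP]]] := mlmc_complexity h_gt0 r0 rho01 h_lower
  h_upper h_null C0 gamma_gt0 Cgamma_gt0 C_rate a0 b2a A0 vv0.
exists Kc, e0; split=> // u e uU /andP[ep ee0].
have [L [M [L1 M0 err cost]]] := cP e (introT andP (conj ep ee0)).
exists L, M; split=> //; last first.
  apply: le_trans cost _; rewrite ler_wpM2l ?(ltW Kc0)//.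
  apply: cost_rate_anti => //; first by rewrite le_max lexx.
  by rewrite ep /= (le_trans (ltW ee0))// (le_trans e01)// -[leRHS]expR0 ler_expR
    lerN10.
(* Replacing [z] by [clamp z] changes neither the samples nor the means, which
   only see the box. *)
pose Yc l z : R^o := Ylevel dc theta u l (clamp z).
pose Xc l z := Xlevel dc theta u l (clamp z).
have bYc l : bsm (Yc l) by exact: bsm_Ylevel.
have bXc l : bsm (Xc l) by exact: bsm_Xlevel.
have bYe := bsm_Yexact theta_gt0 uU.
have bXe := bsm_Xexact theta_gt0 uU.
pose mY := mean mu (Yexact pb theta u).
pose mX := vmean mu (Xexact pb theta u).
pose mYl l : R^o := mean mu (Ylevel dc theta u l).
pose mXl l := vmean mu (Xlevel dc theta u l).
pose dotR (x y : R^o) : R := x * y.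
have wYe : weak_mean mu (box R) dotR (fun z => Yexact pb theta u (clamp z)) mY.
  exact: mean_weak_mean.
have wXe : weak_mean mu (box R) (hdot U) (fun z => Xexact pb theta u (clamp z)) mX.
  exact: vmean_weak_mean.
have wY l : weak_mean mu (box R) dotR (Yc l) (mYl l).
  exact: (mean_weak_mean mu (f := Ylevel dc theta u l) (bYc l)).
have wX l : weak_mean mu (box R) (hdot U) (Xc l) (mXl l).
  exact: (vmean_weak_mean mu (f := Xlevel dc theta u l) (bXc l)).
have biasY l : (1 <= l)%N -> `|mY - mYl l| <= bY * h l `^ a.
  move=> l1; apply: (biasP R^o mYl mY) => //; first exact: CY_gt0.
    move=> i i1; have [iY _] := incr u i.+1 uU isT.
    apply: le_trans iY.
    apply: (mean_sqr_le (W := R^o) mbox mub ipR (f := fun z => Yc i.+1 z - Yc i z)).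
      exact: bsmB.
    exact: weak_meanB.
  move=> i i1; rewrite (_ : mY - mYl i =
    mean mu (fun z => Yexact pb theta u z - Ylevel dc theta u i z)); first exact: Y_bias.
  have bd' : bsm (fun z => Yexact pb theta u (clamp z)
      - Ylevel dc theta u i (clamp z) : R^o) by exact: (@bsmB _ _ _ R^o _ _ bYe (bYc i)).
  apply: (weak_mean_uniq ipR (weak_meanB mbox ipR bYe (bYc i) wYe (wY i))).
  exact: (mean_weak_mean mu
    (f := fun z => Yexact pb theta u z - Ylevel dc theta u i z) bd').
have biasX l : (1 <= l)%N -> `|mX - mXl l| <= bX * h l `^ a.
  move=> l1; apply: (biasP _ mXl mX) => //; first exact: CX_gt0.
    move=> i i1; have [_ iX] := incr u i.+1 uU isT.
    apply: le_trans iX.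
    apply: (mean_sqr_le mbox mub ipU (f := fun z => Xc i.+1 z - Xc i z)).
      exact: bsmB.
    exact: weak_meanB.
  move=> i i1; rewrite (_ : mX - mXl i =
    vmean mu (fun z => Xexact pb theta u z - Xlevel dc theta u i z)); first exact: X_bias.
  have bd' : bsm (fun z => Xexact pb theta u (clamp z)
      - Xlevel dc theta u i (clamp z)) by exact: bsmB bXe (bXc i).
  apply: (weak_mean_uniq ipU (weak_meanB mbox ipU bXe (bXc i) wXe (wX i))).
  exact: (vmean_weak_mean mu
    (f := fun z => Xexact pb theta u z - Xlevel dc theta u i z) bd').
have gpe := galerkin_pair_exact pb u.
have mY1 : 1 <= mY.
  have -> : mY = \int[mu]_(z in box R) Yexact pb theta u (clamp z).
    by have := wYe 1; rewrite /dotR mulr1 => ->; apply: eq_Rintegral => z _; rewrite mulr1.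
  have {1}-> : (1 : R) = \int[mu]_(z in box R) 1.
    by rewrite Rintegral_cst// [X in fine X]mub mulr1.
  apply: bsm_le_Rintegral => //; first exact: bsm_cst.
  by move=> z _; have [/andP[]] := bd _ _ _ _ uU gpe _ (clamp_box z).
have mXB : `|mX| <= B.
  apply: le_trans (weak_mean_norm_le mbox ipU bXe wXe) _.
  have -> : B = \int[mu]_(z in box R) B.
    by rewrite Rintegral_cst// [X in fine X]mub mulr1.
  apply: bsm_le_Rintegral => //; [exact: bsm_norm|exact: bsm_cst|].
  move=> z _; have [/andP[_ w2] wq _] := bd _ _ _ _ uU gpe _ (clamp_box z).
  by rewrite normrZ ger0_norm ?expR_ge0// ler_pM ?expR_ge0.
have [xib mxi _ _] := xi_iid.
pose Yml om : R^o := ml_sum xi L M Yc om.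
pose Xml om := ml_sum xi L M Xc om.
have YmlE om : ml_sum xi L M (fun l z => Ylevel dc theta u l z : R^o) om = Yml om.
  apply: eq_bigr => l _; congr (_ *: _); apply: eq_bigr => i _.
  by rewrite /Yc !clamp_id//; exact: xib.
have XmlE om : ml_sum xi L M (Xlevel dc theta u) om = Xml om.
  apply: eq_bigr => l _; congr (_ *: _); apply: eq_bigr => i _.
  by rewrite /Xc !clamp_id//; exact: xib.
have errE om : gradJ pb mu theta u - gradJ_ML dc theta xi L M u om =
    mY^-1 *: mX - (Num.max 1 (Yml om))^-1 *: Xml om.
  by rewrite /gradJ /gradJ_ML YmlE XmlE opprD addrACA subrr addr0.
(* Measurability with respect to the samples alone, for the conditional
   expectation. *)
pose sOm := g_sigma_algebraType (sample_events xi).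
have ms l m : measurable_fun setT (xi l m : sOm -> rseq R).
  exact: measurable_sample.
have bYml : bsm (Yml : sOm -> R^o) by apply: bsm_multilevel.
have bXml : bsm (Xml : sOm -> U) by exact: (bsm_multilevel ms bXc).
have bYml' : bsm (Yml : Om -> R^o) by exact: (bsm_multilevel mxi bYc).
have bXml' : bsm (Xml : Om -> U) by exact: (bsm_multilevel mxi bXc).
pose f om := `|gradJ pb mu theta u - gradJ_ML dc theta xi L M u om| ^+ 2.
have fE : f = fun om => `|mY^-1 *: mX - (Num.max 1 (Yml om))^-1 *: Xml om| ^+ 2.
  by apply/funext => om; rewrite /f errE.
have bf : bsm (f : sOm -> R^o).
  rewrite fE; apply: bsm_norm_sqr; apply: bsmB; first exact: bsm_cst.
  by apply: bsmZ => //; exact: bsm_inv_max1.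
have bf' : bsm (f : Om -> R^o).
  rewrite fE; apply: bsm_norm_sqr; apply: bsmB; first exact: bsm_cst.
  by apply: bsmZ => //; exact: bsm_inv_max1.
exists (fun=> \int[P]_om f om); split; first exact: (condexp_samples xi_iid Fk_sub Fk_indep bf).
apply: aeW => _.
have eX := multilevel_error mbox mub ipU mxi (sample_law xi_iid)
  (sample_pair_law xi_iid) (F := Xc) (m := mXl) erefl bXc wX L mX M0.
have eY := multilevel_error (W := R^o) mbox mub ipR mxi (sample_law xi_iid)
  (sample_pair_law xi_iid) (F := Yc) (m := mYl) erefl bYc wY L mY M0.
apply: (@le_trans _ _ (2 * \int[P]_om `|mX - Xml om| ^+ 2 +
    2 * B ^+ 2 * \int[P]_om `|mY - Yml om| ^+ 2)).
  have b1 : bsm (fun om => `|mX - Xml om| ^+ 2 : R^o).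
    by apply: bsm_norm_sqr; apply: bsmB => //; exact: bsm_cst.
  have b2 : bsm (fun om => `|mY - Yml om| ^+ 2 : R^o).
    by apply: (@bsm_norm_sqr _ _ _ R^o); apply: (@bsmB _ _ _ R^o) => //; exact: bsm_cst.
  rewrite -!bsm_RintegralZl// -bsm_RintegralD//; last 2 first.
  - by apply: bsm_mulr => //; exact: bsm_cst.
  - by apply: bsm_mulr => //; exact: bsm_cst.
  apply: bsm_le_Rintegral => //.
    by apply: bsm_addr; apply: bsm_mulr => //; exact: bsm_cst.
  move=> om _; rewrite fE /=.
  have := ratio_error mX (Xml om) (Yml om) mY1.
  set E : R := `|mX - Xml om|; set F : R := `|mY - Yml om|; set G : R := `|_| => GE.
  have {}GE : G <= E + B * F by rewrite (le_trans GE)// lerD2l ler_wpM2r ?normr_ge0.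
  have [E0 F0 G0] : [/\ 0 <= E, 0 <= F & 0 <= G] by split; exact: normr_ge0.
  apply: (@le_trans _ _ ((E + B * F) ^+ 2)).
    by rewrite ler_sqr ?nnegrE // addr_ge0 // mulr_ge0 // ltW.
  rewrite -subr_ge0; apply: le_trans (sqr_ge0 (E - B * F)) _.
  rewrite le_eqVlt; apply/orP; left; apply/eqP; ring.
have sumle (Z : nat -> R) :
    (forall l, (1 <= l)%N -> Z l <= v * h l `^ beta) ->
    \sum_(1 <= l < L.+1) (M l)%:R^-1 * Z l <=
    v * \sum_(1 <= l < L.+1) h l `^ beta / (M l)%:R.
  move=> Zle; rewrite mulr_sumr big_nat_cond [leRHS]big_nat_cond.
  apply: ler_sum => l; rewrite andbT => /andP[l1 _].
  by rewrite mulrC mulrA ler_wpM2r ?invr_ge0 ?ler0n// Zle.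
set S := \sum_(1 <= l < L.+1) h l `^ beta / (M l)%:R in err sumle.
have sX := sumle _ (fun l l1 => proj2 (incr u l uU l1)).
have sY := sumle _ (fun l l1 => proj1 (incr u l uU l1)).
have hsq c (x : R) : 0 <= x -> 0 < c -> x <= c * h L `^ a ->
    x ^+ 2 <= c ^+ 2 * h L `^ (2 * a).
  move=> x0 c0 xc; have -> : h L `^ (2 * a) = (h L `^ a) ^+ 2.
    by rewrite expr2 -powR_add ?h_gt0//; congr (_ `^ _); ring.
  by rewrite -exprMn ler_sqr ?nnegrE ?mulr_ge0 ?powR_ge0 ?(ltW c0).
have qX := hsq _ _ (normr_ge0 _) bX0 (biasX L L1).
have qY := hsq _ _ (normr_ge0 _) bY0 (biasY L L1).
apply: le_trans err; rewrite /A /vv.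
have e1 : \int[P]_om `|mX - Xml om| ^+ 2 <=
    2 * (bX ^+ 2 * h L `^ (2 * a)) + 2 * (v * S).
  by apply: le_trans eX _; rewrite lerD ?ler_wpM2l.
have e2 : \int[P]_om `|mY - Yml om| ^+ 2 <=
    2 * (bY ^+ 2 * h L `^ (2 * a)) + 2 * (v * S).
  by apply: le_trans eY _; rewrite lerD ?ler_wpM2l.
have B2 : 0 <= 2 * B ^+ 2 by rewrite mulr_ge0 ?sqr_ge0.
apply: le_trans (lerD (ler_wpM2l (ler0n _ 2) e1) (ler_wpM2l B2 e2)) _.
rewrite le_eqVlt; apply/orP; left; apply/eqP; ring.
Qed.
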